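(* Let $g_1,\dots,g_m\in\mathbb{R}[x]=\mathbb{R}[x_1,\dots,x_n]$ be even polynomials such that $g_1=L-\|x\|_2^2$ for some $L>0$ and $g_m=1$, and let $$S:=\{x\in\mathbb{R}^n : g_1(x)\ge 0,\dots,g_m(x)\ge 0\}.$$ Let $f\in\mathbb{R}[x]$ be an even polynomial that is nonnegative on $S$, let $d_f:=\lfloor \deg(f)/2\rfloor+1$, and let $f^\star:=\sup_{x\in S}f(x)$. For $k\in\mathbb{N}$ and $s\in\mathbb{N}\setminus\{0\}$, let $\rho_{k,s}$ be the infimum of all $\lambda\in\mathbb{R}$ for which there exist $\sigma_1,\dots,\sigma_m\in\Sigma_s$ with $\deg(\sigma_j g_j)\le 2(k+d_f)$ for $j=1,\dots,m$ and $$(1+\|x\|_2^2)^k(\lambda-f)=\sum_{j=1}^m\sigma_j g_j.$$ Then the following statements hold: 1. For all $k\in\mathbb{N}$ and for every $s\in\mathbb{N}\setminus\{0\}$, $\rho_{k,1}\ge\rho_{k,s}\ge f^\star$. 2. For every $s\in\mathbb{N}\setminus\{0\}$, the sequence $(\rho_{k,s})_{k\in\mathbb{N}}$ converges to $f^\star$. 3. If $S$ has nonempty interior, there exist positive constants $\bar c$ and $c$ depending on $f$ and $S$ such that for every $s\in\mathbb{N}\setminus\{0\}$ and for every $k\in\mathbb{N}$, $$0\le\rho_{k,s}-f^\star\le\left(\frac{k}{\bar c}\right)^{-\frac1c}.$$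
   Context: $\mathbb{N}$ denotes the nonnegative integers, and $\|x\|_2^2=x_1^2+\dots+x_n^2$. A polynomial $p\in\mathbb{R}[x_1,\dots,x_n]$ is called even if it is invariant under any variable sign flip, i.e. $p$ is unchanged when any single variable $x_i$ is replaced by $-x_i$. For $\alpha\in\mathbb{N}^n$, $x^\alpha=x_1^{\alpha_1}\cdots x_n^{\alpha_n}$. For $s\in\mathbb{N}\setminus\{0\}$, an $s$-nomial square is a polynomial that can be written as $\left(\sum_{i=1}^s a_i x^{\alpha(i)}\right)^2$ with $a_i\in\mathbb{R}$ and $\alpha(i)\in\mathbb{N}^n$ for $i=1,\dots,s$. $\Sigma_s$ denotes the set of finite sums of $s$-nomial squares. The zero polynomial belongs to $\Sigma_s$ and is regarded as satisfying every upper bound on the degree. Infima and suprema are taken in the extended reals (the infimum of the empty set is $+\infty$). In item 3, for $k=0$ the right-hand side $(k/\bar c)^{-1/c}$ is read as $+\infty$. *)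

(* Defs.v *)
From mathcomp Require Import all_boot all_order all_algebra.
From mathcomp Require Import all_classical all_reals all_analysis.
(* The notations of mpoly clash with those of mathcomp-analysis:
   {mpoly R[n]}, c%:MP_[n], 'X_[m], 'X_i, p.@[v], p \mPo lq are written
   mpoly n R, mpolyC n c, mpolyX R m, mpolyX R (mnm1 i), meval v p,
   comp_mpoly lq p. *)
From mathcomp Require Import -(notations) mpoly.

Set Implicit Arguments.
Unset Strict Implicit.
Unset Printing Implicit Defensive.

Import Order.TTheory GRing.Theory Num.Theory.
Import numFieldNormedType.Exports.

Local Open Scope classical_set_scope.
Local Open Scope ring_scope.

Definition sign_flip (R : realType) (n : nat) (i : 'I_n) :
    n.-tuple (mpoly n R) :=
  [tuple if j == i then - mpolyX R (mnm1 j) else mpolyX R (mnm1 j) | j < n].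

Definition even_mpoly (R : realType) (n : nat) (p : mpoly n R) : Prop :=
  forall i : 'I_n, comp_mpoly (sign_flip R i) p = p.

Definition sqnormX (R : realType) (n : nat) : mpoly n R :=
  \sum_(i < n) mpolyX R (mnm1 i) ^+ 2.

(* msize p is 1 + deg p for p != 0, and msize 0 = 0. *)
Definition deg_le (R : realType) (n : nat) (p : mpoly n R) (d : nat) : Prop :=
  (msize p <= d.+1)%N.

(* floor(deg f / 2) + 1, with the convention deg 0 = 0. *)
Definition half_deg_succ (R : realType) (n : nat) (f : mpoly n R) : nat :=
  ((msize f).-1 %/ 2 + 1)%N.

(* The exponents alpha i need not be distinct and the coefficients a i may
   vanish. *)
Definition nomial_square (R : realType) (n s : nat) (p : mpoly n R) : Prop :=
  exists (a : 'I_s -> R) (alpha : 'I_s -> multinom n),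
    p = (\sum_(i < s) a i *: mpolyX R (alpha i)) ^+ 2.

Definition Sigma (R : realType) (n s : nat) : set (mpoly n R) :=
  [set p | exists2 l : seq (mpoly n R),
     (forall q, q \in l -> nomial_square s q) & p = \sum_(q <- l) q].

Definition feasible_set (R : realType) (n m : nat) (g : 'I_m -> mpoly n R) :
    set 'rV[R]_n :=
  [set x | forall j, 0 <= meval (x ord0) (g j)].

(* A supremum in \bar R: it is -oo when the feasible set is empty. *)
Definition fstar (R : realType) (n m : nat) (g : 'I_m -> mpoly n R)
    (f : mpoly n R) : \bar R :=
  ereal_sup [set (meval (x ord0) f)%:E | x in feasible_set g].

Definition certified_bound (R : realType) (n m : nat) (g : 'I_m -> mpoly n R)
    (f : mpoly n R) (k s : nat) (lambda : R) : Prop :=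
  exists sigma : 'I_m -> mpoly n R,
    [/\ forall j, Sigma s (sigma j),
        forall j, deg_le (sigma j * g j) (2 * (k + half_deg_succ f)) &
        (1 + sqnormX R n) ^+ k * (mpolyC n lambda - f) =
          \sum_(j < m) sigma j * g j].

Definition rho (R : realType) (n m : nat) (g : 'I_m -> mpoly n R)
    (f : mpoly n R) (k s : nat) : \bar R :=
  ereal_inf [set lambda%:E | lambda in certified_bound g f k s].

(* (k / cbar) ^ (- 1 / c); powR would give 0 instead of +oo at k = 0. *)
Definition rate (R : realType) (cbar c : R) (k : nat) : \bar R :=
  if k == 0%N then +oo%E else (powR (k%:R / cbar) (- (1 / c)))%:E.

(* Main.v *)
Require Import Defs.
From mathcomp Require Import all_boot all_order all_algebra.
From mathcomp Require Import all_classical all_reals all_analysis.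
From mathcomp Require Import -(notations) mpoly.
From mathcomp Require Import zify ring lra.
From mathcomp Require ordered_qelim qe_rcf.

(** Every rho_{k,s} lies between the maximum of f and rho_{k,1}, so it is enough
    to produce good certificates made of squares of single terms.  After the substitution
    y_i = x_i^2, such sums of squares are the polynomials with nonnegative
    coefficients in y, and the question becomes one about Polya-type
    certificates on the orthant y >= 0: write
    (1 + |y|)^k (lam - F) = sum_j sigma_j G_j where |y| is the sum of the y_i and
    the sigma_j have nonnegative coefficients.

    Divide by (1 + |y|) to a suitable power, that is, pass to the points
    v = y / (1 + |y|) of a simplex.  A polynomial of degree at most N in y is
    determined by its Bernstein coefficients, indexed by the grid of mesh 1/N on
    this simplex, and multiplying a polynomial with Bernstein coefficients
    psi(b/N) by a fixed polynomial G amounts, up to O(1/N), to multiplying psi by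
    the homogenization of G ([bernstein_formM]).  Hence any Lipschitz function
    psi_j >= 0 on the simplex provides a multiplier sigma_j.  Taking
    psi_j = C max(0, - gamma_j), where gamma_j is the homogenization of G_j, the
    difference (1 + |y|)^k (lam - F) - sum_j sigma_j G_j follows the function
    h + C sum_j max(0, - gamma_j)^2, where h is the homogenization of lam - F.
    This penalized function is positive for C large, so for k large all
    coefficients of the difference are nonnegative, and the difference goes to
    the multiplier of the constraint 1 ([polya_certificate]).
    Quantitatively, if f <= lam - eta on the set where each constraint is
    violated by at most delta, then k of order 1 / (delta^2 eta) suffices
    ([penalty_lower_bound], [certified_bound_of_gap]).

    Convergence follows because, by compactness, every lam above the maximum has
    such a pair delta, eta ([relaxed_upper_bound]).  For the rate one needs delta
    to be polynomial in eta, a Lojasiewicz inequality.  The function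
    phi(a) = sup of f over the set relaxed by a is definable, so quantifier
    elimination over real closed fields gives a nonzero polynomial P with
    P(a, phi(a)) = 0, and an algebraic function that tends to the maximum does so
    at a polynomial rate ([algebraic_rate], [relaxed_rate]). *)

Set Implicit Arguments.
Unset Strict Implicit.
Unset Printing Implicit Defensive.

Import Order.TTheory GRing.Theory Num.Theory.
Import numFieldNormedType.Exports.
Import ordered_qelim.

Local Open Scope classical_set_scope.
Local Open Scope ring_scope.

(** * Multinomial weights *)

Definition simplex_poly (R : realType) (n : nat) : mpoly n R :=
  1 + \sum_(i < n) mpolyX R (mnm1 i).

(** The multinomial coefficient N! / (b! (N - |b|)!), read off the expansion of
    (1 + y_1 + ... + y_n)^N so that it vanishes by itself when |b| > N. *)
Definition multinomial (R : realType) (n N : nat) (b : multinom n) : R :=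
  mcoeff b (simplex_poly R n ^+ N).

Lemma mcoeff_mulXU (R : realType) (n : nat) (p : mpoly n R) (i : 'I_n)
    (b : multinom n) :
  mcoeff b (mpolyX R (mnm1 i) * p) =
  if b i == 0%N then 0 else mcoeff (mnm_sub b (mnm1 i)) p.
Proof.
rewrite mulrC; case: eqP => [bi0|/eqP bi]; last first.
  rewrite -{1}(submK (m := mnm1 i) (m' := b)) ?lep1mP //.
  by rewrite addmC mcoeffMX.
apply/eqP; rewrite mcoeff_eq0 (perm_mem (msuppMX _ _)); apply/negP => /mapP[m _ bE].
by have := bi0; rewrite bE mnmDE mnm1E eqxx.
Qed.

Lemma mderiv_simplex_poly (R : realType) (n N : nat) (i : 'I_n) :
  mderiv i (simplex_poly R n ^+ N.+1) = simplex_poly R n ^+ N *+ N.+1.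
Proof.
have dS : mderiv i (simplex_poly R n) = 1.
  rewrite mderivD -mpolyC1 mderivC add0r raddf_sum (bigD1 i) //= big1.
    have -> : mderiv i (mpolyX R (mnm1 i)) = 1.
      rewrite mderivX mnm1E eqxx scale1r -mpolyX0; congr mpolyX.
      by apply/mnmP => j; rewrite mnmBE subnn mnm0E.
    by rewrite addr0.
  by move=> j ji; rewrite mderivX mnm1E (negPf ji) scale0r.
elim: N => [|N IH]; first by rewrite expr1 dS.
by rewrite exprS mderivM IH dS mul1r mulrnAr -exprS -mulrS.
Qed.

(** Compare coefficients in the derivative of (1 + y_1 + ... + y_n)^(N+1) along
    the i-th variable. *)
Lemma multinomial_step (R : realType) (n N : nat) (b : multinom n) (i : 'I_n) :
  (b i)%:R * multinomial R N.+1 b =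
  N.+1%:R * (if b i == 0%N then 0 else multinomial R N (mnm_sub b (mnm1 i))).
Proof.
case: eqP => [->|/eqP bi]; first by rewrite mul0r mulr0.
have bE : mnm_add (mnm_sub b (mnm1 i)) (mnm1 i) = b by rewrite submK ?lep1mP.
have := mcoeff_deriv i (mnm_sub b (mnm1 i)) (simplex_poly R n ^+ N.+1).
rewrite mderiv_simplex_poly mcoeffMn bE mnmBE mnm1E eqxx subn1 prednK ?lt0n //.
by rewrite /multinomial mulr_natl mulr_natl => ->.
Qed.

(** The homogenizing variable obeys the same rule as the others: its exponent in
    the monomial b of level N.+1 is N.+1 - |b|.  This follows from Pascal's rule
    by subtracting the n identities of [multinomial_step]. *)
Lemma multinomial_slack (R : realType) (n N : nat) (b : multinom n) :
  (N.+1%:R - (mdeg b)%:R) * multinomial R N.+1 b = N.+1%:R * multinomial R N b.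
Proof.
have mE : multinomial R N.+1 b = multinomial R N b +
    \sum_(i < n) if b i == 0%N then 0 else multinomial R N (mnm_sub b (mnm1 i)).
  rewrite /multinomial exprS {1}/simplex_poly mulrDl mul1r mcoeffD; congr (_ + _).
  by rewrite mulr_suml raddf_sum /=; apply: eq_bigr => i _; rewrite mcoeff_mulXU.
rewrite mulrBl mdegE natr_sum mulr_suml.
under eq_bigr do rewrite multinomial_step.
by rewrite -mulr_sumr {1}mE mulrDr addrK.
Qed.

Lemma multinomial_gt_eq0 (R : realType) (n N : nat) (b : multinom n) :
  (N < mdeg b)%N -> multinomial R N b = 0.
Proof.
elim: N b => [|N IH] b Nb.
  rewrite /multinomial expr0 mcoeff1; case: eqP => // b0.
  by rewrite b0 mdeg0 in Nb.
have := multinomial_slack R N b; rewrite IH 1?ltnW // mulr0 => /eqP.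
by rewrite mulf_eq0 subr_eq0 eqr_nat ltn_eqF //= => /eqP.
Qed.

Lemma multinomial_ge0 (R : realType) (n N : nat) (b : multinom n) :
  0 <= multinomial R N b.
Proof.
elim: N b => [|N IH] b; first by rewrite /multinomial expr0 mcoeff1 ler0n.
rewrite /multinomial exprS mulrDl mul1r mcoeffD addr_ge0 ?IH //.
rewrite mulr_suml raddf_sum sumr_ge0 //= => i _.
by rewrite mcoeff_mulXU; case: ifP => // _; exact: IH.
Qed.

(** * Bounded Lipschitz functions on the simplex *)

Lemma mnm_le_mdeg (n : nat) (b : multinom n) (i : 'I_n) : (b i <= mdeg b)%N.
Proof. by rewrite mdegE (bigD1 i) //= leq_addr. Qed.

(** The simplex in n+1 coordinates, described by its last n coordinates; the
    remaining one is [slack]. *)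
Definition std_simplex (R : realType) (n : nat) : set ('I_n -> R) :=
  [set v | (forall i, 0 <= v i) /\ \sum_i v i <= 1].

(** When N = 0 this is the origin, by the convention x / 0 = 0, which is the right
    value for the only monomial of degree 0. *)
Definition grid_point (R : realType) (n N : nat) (b : multinom n) : 'I_n -> R :=
  fun i => (b i)%:R / N%:R.

Definition slack (R : realType) (n : nat) (v : 'I_n -> R) : R := 1 - \sum_i v i.

Lemma sum_grid_point (R : realType) (n N : nat) (b : multinom n) :
  \sum_i grid_point R N b i = (mdeg b)%:R / N%:R.
Proof. by rewrite -mulr_suml mdegE natr_sum. Qed.

Lemma grid_point_simplex (R : realType) (n N : nat) (b : multinom n) :
  (mdeg b <= N)%N -> std_simplex (grid_point R N b).
Proof.
move=> bN; split=> [i|]; first by rewrite divr_ge0.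
rewrite sum_grid_point; case: N bN => [|N] bN; first by rewrite invr0 mulr0.
by rewrite ler_pdivrMr ?ltr0Sn // mul1r ler_nat.
Qed.

Definition dist1 (R : realType) (n : nat) (v w : 'I_n -> R) : R :=
  \sum_i `|v i - w i|.

(** The two lemmas below measure how far a grid point moves when the level is
    raised by one, the extra factor being 1 here and a variable in the next one.
    Both displacements are O(1/N), which is where the rate of Polya's theorem
    comes from. *)
Lemma dist_grid_point_up (R : realType) (n N : nat) (b : multinom n) :
  (mdeg b <= N)%N ->
  dist1 (grid_point R N b) (grid_point R N.+1 b) <= 2 / N.+1%:R.
Proof.
move=> bN; apply: (@le_trans _ _ (\sum_i grid_point R N b i / N.+1%:R)).
  apply: ler_sum => i _; rewrite /grid_point.
  case: N bN => [|N] bN.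
    have -> : b i = 0%N.
      by apply/eqP; rewrite -leqn0 (leq_trans (mnm_le_mdeg b i)).
    by rewrite !mul0r subr0 normr0.
  have N1 : (N.+1%:R : R) != 0 by rewrite pnatr_eq0.
  have N2 : (N.+2%:R : R) != 0 by rewrite pnatr_eq0.
  have -> : (b i)%:R / N.+1%:R - (b i)%:R / N.+2%:R =
      (b i)%:R / N.+1%:R / N.+2%:R :> R.
    move: N1 N2; rewrite -(natr1 N.+1); move: (N.+1%:R) => x x0 x1.
    by field; rewrite x0 x1.
  by rewrite ger0_norm // !divr_ge0.
rewrite -mulr_suml ler_wpM2r ?invr_ge0 //.
have [_ /le_trans] := grid_point_simplex R bN; apply.
by rewrite ler1n.
Qed.

Lemma dist_grid_point_shift (R : realType) (n N : nat) (b : multinom n) (i : 'I_n) :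
  (mdeg b <= N)%N ->
  dist1 (grid_point R N b) (grid_point R N.+1 (mnm_add b (mnm1 i))) <= 2 / N.+1%:R.
Proof.
move=> bN.
apply: (@le_trans _ _ (\sum_j (grid_point R N b j / N.+1%:R + (j == i)%:R / N.+1%:R))).
  apply: ler_sum => j _; rewrite /grid_point mnmDE mnm1E [i == j]eq_sym.
  have -> : (b j)%:R / N%:R - (b j + (j == i))%:R / N.+1%:R =
      (b j)%:R / N%:R / N.+1%:R - (j == i)%:R / N.+1%:R :> R.
    case: N bN => [|N] bN.
      have -> : b j = 0%N.
        by apply/eqP; rewrite -leqn0 (leq_trans (mnm_le_mdeg b j)).
      by rewrite !mul0r.
    have N1 : (N.+1%:R : R) != 0 by rewrite pnatr_eq0.
    have N2 : (N.+2%:R : R) != 0 by rewrite pnatr_eq0.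
    move: N1 N2; rewrite natrD -(natr1 N.+1); move: (N.+1%:R) => x x0 x1.
    by field; rewrite x0 x1.
  apply: le_trans (ler_normB _ _) _.
  by rewrite !ger0_norm // !divr_ge0.
rewrite big_split /= -!mulr_suml -mulrDl ler_wpM2r ?invr_ge0 //.
have [_] := grid_point_simplex R bN; rewrite /grid_point -mulr_suml => le1.
apply: le_trans (lerD le1 (lexx _)) _.
by rewrite (bigD1 i) //= eqxx big1 ?addr0 // => j /negPf ->.
Qed.

Definition bounded_lipschitz (R : realType) (n : nat) (K : R) (psi : ('I_n -> R) -> R) :=
  (forall v, std_simplex v -> `|psi v| <= K) /\
  (forall v w, std_simplex v -> std_simplex w -> `|psi v - psi w| <= K * dist1 v w).

Section BoundedLipschitz.
Context (R : realType) (n : nat).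
Implicit Types (psi phi : ('I_n -> R) -> R) (v w : 'I_n -> R).

Lemma dist1_ge0 v w : 0 <= dist1 v w.
Proof. by apply: sumr_ge0 => i _. Qed.

Lemma std_simplex0 : std_simplex ((fun=> 0) : 'I_n -> R).
Proof. by split=> //; rewrite big1 ?ler01. Qed.

Lemma bounded_lipschitz_ge0 K psi : bounded_lipschitz K psi -> 0 <= K.
Proof. by case=> /(_ _ std_simplex0) bK _; exact: le_trans bK. Qed.

Lemma bounded_lipschitz_cst c : bounded_lipschitz `|c| (fun _ : 'I_n -> R => c).
Proof.
by split=> // v w _ _; rewrite subrr normr0 mulr_ge0 ?dist1_ge0.
Qed.

Lemma bounded_lipschitz_coord i : bounded_lipschitz 1 (fun v : 'I_n -> R => v i).
Proof.
split=> [v [v0 v1]|v w _ _].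
  rewrite ger0_norm //; apply: le_trans v1; rewrite (bigD1 i) //= lerDl.
  exact: sumr_ge0.
by rewrite mul1r /dist1 (bigD1 i) //= lerDl sumr_ge0.
Qed.

Lemma bounded_lipschitz_slack : bounded_lipschitz 1 (@slack R n).
Proof.
split=> [v [v0 v1]|v w _ _]; rewrite /slack.
  by rewrite ger0_norm ?subr_ge0 // gerBl sumr_ge0.
have -> : 1 - \sum_i v i - (1 - \sum_i w i) = - (\sum_i v i - \sum_i w i) by ring.
by rewrite mul1r normrN -sumrB ler_norm_sum.
Qed.

Lemma bounded_lipschitzD K K' psi phi :
  bounded_lipschitz K psi -> bounded_lipschitz K' phi ->
  bounded_lipschitz (K + K') (fun v => psi v + phi v).
Proof.
move=> [b l] [b' l']; split=> [v sv|v w sv sw].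
  by rewrite (le_trans (ler_normD _ _)) // lerD ?b ?b'.
by rewrite opprD addrACA (le_trans (ler_normD _ _)) // mulrDl lerD ?l ?l'.
Qed.

Lemma bounded_lipschitzM K K' psi phi :
  bounded_lipschitz K psi -> bounded_lipschitz K' phi ->
  bounded_lipschitz (K * K' *+ 2) (fun v => psi v * phi v).
Proof.
move=> Kpsi Kphi.
have K0 := bounded_lipschitz_ge0 Kpsi; have K'0 := bounded_lipschitz_ge0 Kphi.
case: Kpsi Kphi => [b l] [b' l']; split=> [v sv|v w sv sw].
  rewrite normrM (@le_trans _ _ (K * K')) ?ler_pM ?b ?b' //.
  by rewrite mulr2n lerDl mulr_ge0.
have -> : psi v * phi v - psi w * phi w =
    (psi v - psi w) * phi v + psi w * (phi v - phi w) by ring.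
rewrite (le_trans (ler_normD _ _)) // !normrM mulr2n mulrDl lerD //.
  by rewrite mulrAC ler_pM ?l ?b'.
by rewrite -mulrA ler_pM ?b ?l'.
Qed.

Lemma bounded_lipschitz_negpart K psi :
  bounded_lipschitz K psi -> bounded_lipschitz K (fun v => Num.max 0 (- psi v)).
Proof.
move=> [b l]; split=> [v /b|v w sv sw].
  by case: (leP 0 (- psi v)) => _; rewrite ?normrN // normr0; exact: le_trans.
apply: le_trans (l v w sv sw).
case: (leP 0 (- psi v)) => hv; case: (leP 0 (- psi w)) => hw.
- by rewrite -opprD normrN.
- rewrite subr0 normrN ler0_norm; last by lra.
  by rewrite ler0_norm; lra.
- rewrite sub0r opprK ler0_norm; last by lra.
  by rewrite ger0_norm; lra.
- by rewrite subrr normr0.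
Qed.

End BoundedLipschitz.

(** * Bernstein forms of polynomials *)

Section BernsteinForm.
Context (R : realType) (n : nat).
Implicit Types (p q : mpoly n R) (psi phi : ('I_n -> R) -> R) (e K : R).

(** The Bernstein coefficients theta of p at level N follow the function psi on
    the grid, up to the error e.  The point of this predicate is that it is
    stable under multiplication of p by a fixed polynomial G, psi being
    multiplied by the homogenization of G, at the price of an error O(1/N). *)
Definition bernstein_form (N : nat) p psi e : Prop :=
  exists2 theta : multinom n -> R,
    forall b, mcoeff b p = multinomial R N b * theta b &
    forall b, (mdeg b <= N)%N -> `|theta b - psi (grid_point R N b)| <= e.

(** This is the reason for the multiplier (1 + |x|^2)^k in the hierarchy: its
    Bernstein coefficients are all equal to 1. *)
Lemma bernstein_form_power N : bernstein_form N (simplex_poly R n ^+ N) (fun=> 1) 0.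
Proof.
exists (fun=> 1) => b; first by rewrite mulr1.
by rewrite subrr normr0.
Qed.

(** The Bernstein operator: it realizes any function psi, with nonnegative
    coefficients as soon as psi is nonnegative.  The multipliers of the
    certificate are chosen in its image. *)
Definition bernstein (N : nat) psi : mpoly n R :=
  \sum_(b <- msupp (simplex_poly R n ^+ N))
    (multinomial R N b * psi (grid_point R N b)) *: mpolyX R b.

Lemma mcoeff_bernstein N psi b :
  mcoeff b (bernstein N psi) = multinomial R N b * psi (grid_point R N b).
Proof.
rewrite raddf_sum /=; under eq_bigr do rewrite mcoeffZ mcoeffX.
have [bs|bs] := boolP (b \in msupp (simplex_poly R n ^+ N)).
  rewrite (bigD1_seq b) //= ?msupp_uniq // eqxx mulr1 big1 ?addr0 // => c.
  by move=> /negPf ->; rewrite mulr0.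
rewrite /multinomial (memN_msupp_eq0 bs) mul0r big1_seq // => c /= cs.
by case: eqP => [cb|_]; rewrite ?mulr0 // -cb cs in bs *.
Qed.

Lemma bernstein_form_bernstein N psi : bernstein_form N (bernstein N psi) psi 0.
Proof.
exists (fun b => psi (grid_point R N b)) => b; first exact: mcoeff_bernstein.
by rewrite subrr normr0.
Qed.

Lemma bernstein_formD N p q psi phi e e' :
  bernstein_form N p psi e -> bernstein_form N q phi e' ->
  bernstein_form N (p + q) (fun v => psi v + phi v) (e + e').
Proof.
move=> [t tE te] [u uE ue]; exists (fun b => t b + u b) => b.
  by rewrite mcoeffD tE uE mulrDr.
by move=> bN; rewrite opprD addrACA (le_trans (ler_normD _ _)) // lerD ?te ?ue.
Qed.

Lemma bernstein_formZ N c p psi e :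
  bernstein_form N p psi e ->
  bernstein_form N (c *: p) (fun v => c * psi v) (`|c| * e).
Proof.
move=> [t tE te]; exists (fun b => c * t b) => b.
  by rewrite mcoeffZ tE mulrCA.
by move=> bN; rewrite -mulrBr normrM ler_wpM2l ?te.
Qed.

Lemma bernstein_form_sum N (I : Type) (s : seq I) (p : I -> mpoly n R)
    (psi : I -> ('I_n -> R) -> R) (e : I -> R) :
  (forall i, bernstein_form N (p i) (psi i) (e i)) ->
  bernstein_form N (\sum_(i <- s) p i) (fun v => \sum_(i <- s) psi i v)
    (\sum_(i <- s) e i).
Proof.
move=> form; elim: s => [|i s IH].
  by exists (fun=> 0) => b; rewrite !big_nil ?mcoeff0 ?mulr0 // subrr normr0.
have [t tE te] := bernstein_formD (form i) IH; exists t => b.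
  by rewrite big_cons tE.
by move=> bN; rewrite !big_cons; exact: te.
Qed.

Lemma bernstein_form_weaken N p psi phi e e' :
  bernstein_form N p psi e -> (forall v, psi v = phi v) -> e <= e' ->
  bernstein_form N p phi e'.
Proof.
by move=> [t tE te] eq_psi ee'; exists t => // b /te; rewrite eq_psi => /le_trans; apply.
Qed.

(** The same polynomial regarded one level higher; this is multiplication by the
    homogenizing variable. *)
Lemma bernstein_form_up N p psi e K :
  bounded_lipschitz K psi -> 0 <= e -> bernstein_form N p psi e ->
  bernstein_form N.+1 p (fun v => slack v * psi v) (e + K * (2 / N.+1%:R)).
Proof.
move=> Kpsi e0 [t tE te]; have K0 := bounded_lipschitz_ge0 Kpsi.
have N1 : 0 < N.+1%:R :> R by [].
have slackE b : slack (grid_point R N.+1 b) = (N.+1%:R - (mdeg b)%:R) / N.+1%:R :> R.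
  by rewrite /slack sum_grid_point mulrBl divff ?gt_eqF.
exists (fun b => slack (grid_point R N.+1 b) * t b) => b.
  rewrite tE slackE mulrA [multinomial R N.+1 b * _]mulrA.
  rewrite [multinomial R N.+1 b * _]mulrC multinomial_slack.
  by rewrite [N.+1%:R * _]mulrC mulfK // gt_eqF.
rewrite leq_eqVlt ltnS => /predU1P[bN|bN].
  rewrite slackE bN subrr !mul0r subrr normr0.
  by rewrite addr_ge0 // mulr_ge0 // divr_ge0.
have bN1 : (mdeg b <= N.+1)%N by rewrite ltnW.
have sb := grid_point_simplex R bN; have sb1 := grid_point_simplex R bN1.
rewrite -mulrBr normrM -[X in _ <= X]mul1r ler_pM //.
  by case: (bounded_lipschitz_slack R n) => /(_ _ sb1).
rewrite -[t b](subrK (psi (grid_point R N b))) -addrA (le_trans (ler_normD _ _)) // lerD ?te //.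
case: Kpsi => _ /(_ _ _ sb sb1) /le_trans; apply.
by rewrite ler_wpM2l ?dist_grid_point_up.
Qed.

Lemma bernstein_form_mulXU N p psi e K i :
  bounded_lipschitz K psi -> 0 <= e -> bernstein_form N p psi e ->
  bernstein_form N.+1 (mpolyX R (mnm1 i) * p) (fun v => v i * psi v)
    (e + K * (2 / N.+1%:R)).
Proof.
move=> Kpsi e0 [t tE te]; have K0 := bounded_lipschitz_ge0 Kpsi.
have N1 : 0 < N.+1%:R :> R by [].
exists (fun b => grid_point R N.+1 b i * t (mnm_sub b (mnm1 i))) => b.
  rewrite mcoeff_mulXU /grid_point mulrA [multinomial R N.+1 b * _]mulrA.
  rewrite [multinomial R N.+1 b * _]mulrC multinomial_step.
  case: eqP => _; first by rewrite mulr0 !mul0r.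
  by rewrite tE [N.+1%:R * _]mulrC mulfK // gt_eqF.
move=> bN1; have [bi0|bi] := eqVneq (b i) 0%N.
  rewrite /grid_point bi0 !mul0r subrr normr0.
  by rewrite addr_ge0 // mulr_ge0 // divr_ge0.
have [c bE] : exists c, b = mnm_add c (mnm1 i).
  by exists (mnm_sub b (mnm1 i)); rewrite submK ?lep1mP.
have cN : (mdeg c <= N)%N by move: bN1; rewrite bE mdegD mdeg1 addn1.
have sc := grid_point_simplex R cN; have sb := grid_point_simplex R bN1.
rewrite -mulrBr normrM -[X in _ <= X]mul1r ler_pM //.
  by case: (bounded_lipschitz_coord R i) => /(_ _ sb).
rewrite {1}bE addmK.
rewrite -[t c](subrK (psi (grid_point R N c))) -addrA (le_trans (ler_normD _ _)) // lerD ?te //.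
case: Kpsi => _ /(_ _ _ sc sb) /le_trans; apply.
by rewrite ler_wpM2l // bE dist_grid_point_shift.
Qed.

Definition hom_monomial (d : nat) (a : multinom n) (v : 'I_n -> R) : R :=
  slack v ^+ (d - mdeg a) * \prod_i v i ^+ a i.

Definition homogenize (d : nat) p (v : 'I_n -> R) : R :=
  \sum_(a <- msupp p) mcoeff a p * hom_monomial d a v.

Lemma bounded_lipschitzX K psi k : bounded_lipschitz K psi ->
  exists K', bounded_lipschitz K' (fun v => psi v ^+ k).
Proof.
move=> Kpsi; elim: k => [|k [K' IH]]; first by exists `|1 : R|; exact: bounded_lipschitz_cst.
exists (K * K' *+ 2).
have -> : (fun v => psi v ^+ k.+1) = fun v => psi v * psi v ^+ k.
  by apply/funext => v; rewrite exprS.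
exact: bounded_lipschitzM.
Qed.

Lemma bounded_lipschitz_hom_monomial d a :
  exists K, bounded_lipschitz K (hom_monomial d a).
Proof.
have [K1 h1] := bounded_lipschitzX (d - mdeg a) (bounded_lipschitz_slack R n).
suff [K2 h2] : exists K, bounded_lipschitz K (fun v : 'I_n -> R => \prod_i v i ^+ a i).
  by exists (K1 * K2 *+ 2); exact: bounded_lipschitzM.
elim: (index_enum _) => [|i s [K IH]].
  exists `|1 : R|; under eq_fun do rewrite big_nil; exact: bounded_lipschitz_cst.
have [K' h'] := bounded_lipschitzX (a i) (bounded_lipschitz_coord R i).
exists (K' * K *+ 2); under eq_fun do rewrite big_cons.
exact: bounded_lipschitzM.
Qed.

Lemma bounded_lipschitz_homogenize d p :
  exists K, bounded_lipschitz K (homogenize d p).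
Proof.
rewrite /homogenize; elim: (msupp p : seq _) => [|a s [K IH]].
  exists `|0 : R|; under eq_fun do rewrite big_nil; exact: bounded_lipschitz_cst.
have [K' h'] := bounded_lipschitz_hom_monomial d a.
exists (`|mcoeff a p| * K' *+ 2 + K); under eq_fun do rewrite big_cons.
by apply: bounded_lipschitzD => //; apply: bounded_lipschitzM => //; exact: bounded_lipschitz_cst.
Qed.

Lemma hom_monomial_up d a : (mdeg a <= d)%N ->
  forall v, hom_monomial d.+1 a v = slack v * hom_monomial d a v.
Proof. by move=> ad v; rewrite /hom_monomial subSn // exprS mulrA. Qed.

Lemma hom_monomial_mulXU d a i v :
  hom_monomial d.+1 (mnm_add a (mnm1 i)) v = v i * hom_monomial d a v.
Proof.
rewrite /hom_monomial mdegD mdeg1 addn1 subSS mulrCA; congr (_ * _).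
under eq_bigr do rewrite mnmDE exprD.
rewrite big_split /= mulrC; congr (_ * _).
rewrite (bigD1 i) //= mnm1E eqxx expr1 big1 ?mulr1 // => j ji.
by rewrite mnm1E eq_sym (negPf ji).
Qed.

(** Multiply d times in a row, by a variable or by 1.  The constant M is
    independent of the level and of the polynomial p, but not of psi. *)
Lemma bernstein_form_mulX d a psi K :
  (mdeg a <= d)%N -> bounded_lipschitz K psi ->
  exists2 M : R, 0 <= M & forall N p e, 0 <= e -> bernstein_form N p psi e ->
    bernstein_form (N + d) (mpolyX R a * p) (fun v => hom_monomial d a v * psi v)
      (e + M / N.+1%:R).
Proof.
move=> + Kpsi; elim: d a => [|d IH] a.
  rewrite leqn0 mdeg_eq0 => /eqP ->; exists 0 => // N p e _ form.
  rewrite addn0 mpolyX0 mul1r; apply: (bernstein_form_weaken form) => [v|].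
    by rewrite /hom_monomial mdeg0 expr0 mul1r big1 ?mul1r // => i _; rewrite mnm0E.
  by rewrite mul0r addr0.
have mono N : 2 / (N + d).+1%:R <= 2 / N.+1%:R :> R.
  by rewrite ler_wpM2l // lef_pV2 ?posrE // ler_nat ltnS leq_addr.
rewrite leq_eqVlt ltnS => /predU1P[ad|ad].
  have [i ai] : exists i, a i != 0%N.
    apply/existsP; apply: contraPT (ad) => /existsPn a0.
    suff -> : a = mnm0 by rewrite mdeg0.
    by apply/mnmP => i; rewrite mnm0E; apply/eqP; have := a0 i; rewrite negbK.
  have [b aE] : exists b, a = mnm_add b (mnm1 i).
    by exists (mnm_sub a (mnm1 i)); rewrite submK ?lep1mP.
  have bd : (mdeg b <= d)%N by move: ad; rewrite aE mdegD mdeg1 addn1 => -[->].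
  have [M M0 MP] := IH b bd; have [K' h'] := bounded_lipschitz_hom_monomial d b.
  have [L hpsi] : exists L, bounded_lipschitz L (fun v => hom_monomial d b v * psi v).
    by eexists; exact: bounded_lipschitzM h' Kpsi.
  have L0 := bounded_lipschitz_ge0 hpsi.
  exists (M + L * 2) => [|N p e e0 form]; first by rewrite addr_ge0 ?mulr_ge0.
  have := bernstein_form_mulXU i hpsi _ (MP _ _ _ e0 form).
  rewrite addnS aE addmC mpolyXD -mulrA => /(_ _)/bernstein_form_weaken; apply.
  - by rewrite addr_ge0 ?divr_ge0.
  - by move=> v; rewrite addmC hom_monomial_mulXU mulrA.
  - by rewrite -addrA lerD2l [X in _ <= X]mulrDl lerD2l -mulrA ler_wpM2l.
have [M M0 MP] := IH a ad; have [K' h'] := bounded_lipschitz_hom_monomial d a.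
have [L hpsi] : exists L, bounded_lipschitz L (fun v => hom_monomial d a v * psi v).
  by eexists; exact: bounded_lipschitzM h' Kpsi.
have L0 := bounded_lipschitz_ge0 hpsi.
exists (M + L * 2) => [|N p e e0 form]; first by rewrite addr_ge0 ?mulr_ge0.
have := bernstein_form_up hpsi _ (MP _ _ _ e0 form).
rewrite addnS => /(_ _)/bernstein_form_weaken; apply.
- by rewrite addr_ge0 ?divr_ge0.
- by move=> v; rewrite hom_monomial_up // mulrA.
- by rewrite -addrA lerD2l [X in _ <= X]mulrDl lerD2l -mulrA ler_wpM2l.
Qed.

Lemma bernstein_formM d p psi K :
  (msize p <= d.+1)%N -> bounded_lipschitz K psi ->
  exists2 M : R, 0 <= M & forall N q, bernstein_form N q psi 0 ->
    bernstein_form (N + d) (p * q) (fun v => homogenize d p v * psi v) (M / N.+1%:R).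
Proof.
move=> pd Kpsi.
have step (a : multinom n) : exists M : R, a \in msupp p -> 0 <= M /\
    forall N q, bernstein_form N q psi 0 ->
    bernstein_form (N + d) (mpolyX R a * q) (fun v => hom_monomial d a v * psi v)
      (M / N.+1%:R).
  have [ap|] := boolP (a \in msupp p); last by exists 0.
  have ad : (mdeg a <= d)%N by rewrite -ltnS (leq_trans (msize_mdeg_lt ap)).
  have [M M0 MP] := bernstein_form_mulX ad Kpsi; exists M => _; split=> // N q form.
  by have := MP _ _ _ (lexx _) form; rewrite add0r.
have [M MP] := boolp.choice step.
pose M' a := if a \in msupp p then M a else 0.
exists (\sum_(a <- msupp p) `|mcoeff a p| * M' a).
  rewrite sumr_ge0 // => a _; rewrite mulr_ge0 // /M'; case: ifP => // ap.
  by case: (MP a ap).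
move=> N q form; rewrite {1}[p]mpolyE mulr_suml.
have -> : \sum_(a <- msupp p) (mcoeff a p *: mpolyX R a * q) =
    \sum_(a <- msupp p) (if a \in msupp p then mcoeff a p *: (mpolyX R a * q) else 0).
  by rewrite !big_seq; apply: eq_bigr => a ->; rewrite scalerAl.
pose psi' a v := if a \in msupp p then mcoeff a p * (hom_monomial d a v * psi v) else 0.
have forms a : bernstein_form (N + d)
    (if a \in msupp p then mcoeff a p *: (mpolyX R a * q) else 0)
    (psi' a) (`|mcoeff a p| * (M' a / N.+1%:R)).
  rewrite /psi' /M'; case: ifP => ap.
    by apply: bernstein_formZ; have [_] := MP a ap; apply.
  by exists (fun=> 0) => b; rewrite ?mcoeff0 ?mulr0 // mul0r mulr0 subrr normr0.
apply: (bernstein_form_weaken (bernstein_form_sum (msupp p) forms)) => [v|].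
  rewrite mulr_suml !big_seq; apply: eq_bigr => a ap.
  by rewrite /psi' ap mulrA.
by rewrite mulr_suml le_eqVlt; apply/orP; left; apply/eqP/eq_bigr => a _; rewrite mulrA.
Qed.

(** The final step of Polya's theorem: when psi exceeds the error everywhere,
    every coefficient is nonnegative. *)
Lemma bernstein_form_ge0 N p psi e : bernstein_form N p psi e ->
  (forall v, std_simplex v -> e <= psi v) -> forall b, 0 <= mcoeff b p.
Proof.
move=> [t tE te] psi_ge b; rewrite tE.
have [bN|Nb] := leqP (mdeg b) N; last by rewrite multinomial_gt_eq0 ?mul0r.
rewrite mulr_ge0 ?multinomial_ge0 //.
have := te b bN; have := psi_ge _ (grid_point_simplex R bN).
rewrite ler_norml => h1 /andP[h2 _]; lra.
Qed.

Lemma bernstein_form_msize N p psi e : bernstein_form N p psi e -> (msize p <= N.+1)%N.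
Proof.
move=> [t tE _]; rewrite msizeE; apply/bigmax_leqP_seq => b.
rewrite mcoeff_msupp tE => b0 _; rewrite ltnS leqNgt; apply: contra b0 => Nb.
by rewrite multinomial_gt_eq0 ?mul0r.
Qed.

End BernsteinForm.

(** * Certificates with nonnegative coefficients on the orthant *)

Lemma homogenize_meval (R : realType) (n d : nat) (p : mpoly n R) (v : 'I_n -> R) :
  (msize p <= d.+1)%N -> slack v != 0 ->
  homogenize d p v = slack v ^+ d * meval (fun i => v i / slack v) p.
Proof.
move=> pd u0; rewrite /homogenize mevalE mulr_sumr !big_seq; apply: eq_bigr => m mp.
rewrite [in RHS]mulrCA; congr (_ * _); rewrite /hom_monomial.
have md : (mdeg m <= d)%N by rewrite -ltnS (leq_trans (msize_mdeg_lt mp)).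
under [in RHS]eq_bigr do rewrite expr_div_n.
rewrite prodf_div prodrXr -mdegE expfB_cond ?(negPf u0) //.
by rewrite mulrAC mulrA.
Qed.

Lemma homogenize1 (R : realType) (n d : nat) (v : 'I_n -> R) :
  homogenize d 1 v = slack v ^+ d.
Proof.
rewrite /homogenize -mpolyC1 msupp1 big_seq1 mcoeffC eqxx /hom_monomial mdeg0 subn0.
by rewrite big1 ?mul1r ?mulr1 // => i _; rewrite mnm0E.
Qed.

(** The certificate of the hierarchy after the substitution y_i = x_i^2, with
    degrees halved.  The remainder r is later absorbed by the multiplier of the
    constraint 1. *)
Definition orthant_certificate (R : realType) (n m : nat) (G : 'I_m -> mpoly n R)
    (F : mpoly n R) (d k : nat) (lam : R) : Prop :=
  exists (sigma : 'I_m -> mpoly n R) (r : mpoly n R),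
    [/\ forall j b, 0 <= mcoeff b (sigma j),
        forall b, 0 <= mcoeff b r,
        forall j, (msize (sigma j * G j) <= (k + d).+1)%N,
        (msize r <= (k + d).+1)%N &
        simplex_poly R n ^+ k * (mpolyC n lam - F) =
          \sum_j sigma j * G j + r].

Definition penalty (R : realType) (n m : nat) (e : 'I_m -> nat)
    (G : 'I_m -> mpoly n R) (v : 'I_n -> R) : R :=
  \sum_j Num.max 0 (- homogenize (e j) (G j) v) ^+ 2.

(** The homogenization of lam - F to degree d, on the simplex. *)
Definition lifted (R : realType) (n d : nat) (F : mpoly n R) (lam : R)
    (v : 'I_n -> R) : R :=
  lam * slack v ^+ d - homogenize d F v.

(** Take for the multiplier of G_j the Bernstein polynomial of C times the
    negative part of the homogenization gamma_j of G_j.  Then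
    (1 + |y|)^k (lam - F) - sum_j sigma_j G_j follows the function
    lifted + C * penalty on the grid of level k + d, because
    - gamma_j * max(0, - gamma_j) = max(0, - gamma_j)^2, and the error is
    O(C / k).  As soon as mu dominates the error, the difference has nonnegative
    coefficients.  The multipliers are of degree k + d - e_j, so the degree bound
    holds by construction. *)
Lemma polya_certificate (R : realType) (n m d : nat) (e : 'I_m -> nat)
    (G : 'I_m -> mpoly n R) (F : mpoly n R) (Lam : R) :
  (forall j, (msize (G j) <= (e j).+1)%N) -> (msize F <= d.+1)%N -> 0 <= Lam ->
  exists2 K : R, 0 <= K & forall (C mu lam : R) (k : nat),
    1 <= C -> `|lam| <= Lam ->
    (forall v, std_simplex v -> mu <= lifted d F lam v + C * penalty e G v) ->
    (forall j, 2 * e j <= k)%N -> K * C <= mu * k.+1%:R ->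
    orthant_certificate G F d k lam.
Proof.
move=> Ge Fd Lam0.
have cst1 : bounded_lipschitz 1 (fun _ : 'I_n -> R => 1).
  by rewrite -[X in bounded_lipschitz X]normr1; exact: bounded_lipschitz_cst.
have one_d : (msize (1 : mpoly n R) <= d.+1)%N by rewrite msize1.
have [M1 M10 M1P] := bernstein_formM one_d cst1.
have [M2 M20 M2P] := bernstein_formM Fd cst1.
pose neg j v := Num.max 0 (- homogenize (e j) (G j) v).
have negP j : exists M : R, 0 <= M /\ forall N q, bernstein_form N q (neg j) 0 ->
    bernstein_form (N + e j) (G j * q) (fun v => homogenize (e j) (G j) v * neg j v)
      (M / N.+1%:R).
  have [K hK] := bounded_lipschitz_homogenize (e j) (G j).
  have [M M0 MP] := bernstein_formM (Ge j) (bounded_lipschitz_negpart hK).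
  by exists M.
have [M MP] := boolp.choice negP.
have sM0 : 0 <= \sum_j M j by apply: sumr_ge0 => j _; case: (MP j).
exists (Lam * M1 + M2 + 2 * \sum_j M j) => [|C mu lam k C1 lamL low ek KC].
  by rewrite !addr_ge0 // mulr_ge0.
have C0 : 0 <= C by rewrite (le_trans ler01).
(* The level of the j-th multiplier, so that its product with G j has level k + d. *)
pose N j := (k + d - e j)%N.
have NE j : (N j + e j = k + d)%N.
  by rewrite subnK // (leq_trans _ (leq_addr _ _)) // (leq_trans _ (ek j)) // leq_pmull.
pose B j := bernstein (N j) (neg j).
pose sigma j := C *: B j.
have formGB j : bernstein_form (k + d) (G j * B j)
    (fun v => homogenize (e j) (G j) v * neg j v) (M j / (N j).+1%:R).
  rewrite -[X in bernstein_form X](NE j); have [_] := MP j; apply.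
  exact: bernstein_form_bernstein.
have formS := bernstein_formZ (- C) (bernstein_form_sum (index_enum 'I_m) formGB).
have form1 := bernstein_formZ lam (M1P _ _ (bernstein_form_power R n k)).
have formF := bernstein_formZ (-1) (M2P _ _ (bernstein_form_power R n k)).
have := bernstein_formD (bernstein_formD form1 formF) formS.
set r := (_ + _ : mpoly n R); set err := (_ + _ : R) => formr.
have k1 : 0 < k.+1%:R :> R by [].
have err_le : err <= mu.
  have inv_le j : (N j).+1%:R^-1 <= 2 / k.+1%:R :> R.
    rewrite -[X in X <= _]mul1r ler_pdivrMr // mulrAC ler_pdivlMr // mul1r.
    by rewrite -natrM ler_nat; have := ek j; have := NE j; lia.
  rewrite -(ler_pM2r k1) (le_trans _ KC) //.
  have sum_le : \sum_j M j / (N j).+1%:R <= 2 * (\sum_j M j) / k.+1%:R.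
    rewrite mulr_sumr mulr_suml ler_sum // => j _.
    by rewrite [2 * _]mulrC -mulrA ler_wpM2l //; case: (MP j).
  rewrite /err !normrN normr1 (ger0_norm C0) mul1r.
  have -> : (`|lam| * (M1 / k.+1%:R) + M2 / k.+1%:R + C * \sum_j M j / (N j).+1%:R) * k.+1%:R =
     `|lam| * M1 + M2 + C * ((\sum_j M j / (N j).+1%:R) * k.+1%:R).
    by move: k1 (\sum_j _) => + S; move: k.+1%:R => x x0; field; rewrite gt_eqF.
  rewrite ler_pdivlMr // in sum_le.
  rewrite [X in _ <= X]mulrDl lerD //; last by rewrite mulrC ler_wpM2r.
  rewrite -[X in X <= _]mulr1 ler_pM ?addr_ge0 ?mulr_ge0 //.
  by rewrite lerD2r ler_wpM2r.
exists sigma, r; split.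
- move=> j b; rewrite mcoeffZ mulr_ge0 // mcoeff_bernstein mulr_ge0 ?multinomial_ge0 //.
  by rewrite /neg le_max lexx.
- apply: (bernstein_form_ge0 formr) => v /low /(le_trans err_le) /le_trans; apply.
  rewrite /lifted /penalty mulN1r !mulr1 homogenize1.
  rewrite lerD2l mulNr -mulrN -sumrN ler_wpM2l // ler_sum // => j _.
  rewrite /neg; case: (leP 0 (- homogenize _ _ _)) => _.
    by rewrite mulrN opprK sqrrN expr2.
  by rewrite mulr0 oppr0 expr0n.
- move=> j; rewrite -scalerAl mulrC (leq_trans (msizeZ_le _ _)) //.
  exact: bernstein_form_msize (formGB j).
- exact: bernstein_form_msize formr.
have -> : \sum_j sigma j * G j = C *: \sum_j G j * B j.
  by rewrite scaler_sumr; apply: eq_bigr => j _; rewrite /sigma -scalerAl mulrC.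
rewrite /r mul1r scaleN1r scaleNr [RHS]addrC subrK mulrBr.
by rewrite [_ * mpolyC n lam]mulrC mul_mpolyC [F * _]mulrC.
Qed.

(** Near the face slack = 0 this equals -1 up to a small term: the ball constraint
    is violated at infinity, which is what makes the problem compact. *)
Lemma homogenize_affine (R : realType) (n : nat) (L : R) (v : 'I_n -> R) :
  homogenize 1 (mpolyC n L - \sum_(i < n) mpolyX R (mnm1 i)) v =
  (L + 1) * slack v - 1.
Proof.
set p := _ - _.
have p_coeff a : mcoeff a p = L * (a == mnm0)%:R - \sum_(i < n) (mnm1 i == a)%:R.
  rewrite mcoeffB mcoeffC raddf_sum /=; congr (_ - _).
  by apply: eq_bigr => i _; rewrite mcoeffX.
pose s := mnm0 :: [seq mnm1 i | i <- enum 'I_n].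
have s_uniq : uniq s.
  rewrite /= map_inj_uniq ?enum_uniq ?andbT; last by move=> i j /eqP; rewrite eq_mnm1 => /eqP.
  by apply/negP => /mapP[i _ /eqP]; rewrite eq_sym mnm1_eq0.
have ps : {subset msupp p <= s}.
  move=> a; rewrite mcoeff_msupp p_coeff inE; apply: contraNT => /norP[/negPf -> as_].
  rewrite mulr0 big1 ?subr0 // => i _; case: eqP => // ia.
  by case/mapP: as_; exists i; rewrite ?mem_enum.
have -> : homogenize 1 p v = \sum_(a <- s) mcoeff a p * hom_monomial 1 a v.
  rewrite [RHS](bigID (mem (msupp p))) /= [X in _ + X]big1 ?addr0; last first.
    by move=> a /memN_msupp_eq0 ->; rewrite mul0r.
  rewrite -[RHS]big_filter; apply: perm_big; apply: uniq_perm.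
  - exact: msupp_uniq.
  - exact: filter_uniq.
  - by move=> a; rewrite mem_filter andb_idr // => /ps.
rewrite big_cons p_coeff eqxx mulr1 big1 => [|i _]; last by rewrite mnm1_eq0.
rewrite big_map big_enum /= subr0.
have hom0 : hom_monomial 1 mnm0 v = slack v.
  by rewrite /hom_monomial mdeg0 big1 ?mulr1 // => i _; rewrite mnm0E.
have hom1 i : hom_monomial 1 (mnm1 i) v = v i.
  rewrite /hom_monomial mdeg1 expr0 mul1r (bigD1 i) //= mnm1E eqxx big1 ?mulr1 // => j ji.
  by rewrite mnm1E eq_sym (negPf ji).
under eq_bigr => i _.
  rewrite p_coeff hom1 mnm1_eq0 mulr0 sub0r (bigD1 i) //= eqxx big1 ?addr0 ?mulN1r; last first.
    by move=> j ji; rewrite eq_mnm1 (negPf ji).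
  over.
by rewrite hom0 sumrN /slack; ring.
Qed.

(** Three cases on the simplex.  If the slack u is below u0, the ball constraint
    is violated by at least 1/2.  If some constraint is violated by at least
    delta * w, the penalty is of order delta^2.  In both cases a coefficient of
    order 1 / delta^2 makes the penalty win over the bounded function lifted.
    Otherwise y = v / u violates every constraint by at most delta, so that
    lam - F(y) >= eta, and lifted = u^d (lam - F(y)). *)
Lemma penalty_lower_bound (R : realType) (n m d : nat) (e : 'I_m.+1 -> nat)
    (G : 'I_m.+1 -> mpoly n R) (F : mpoly n R) (L Lam : R) :
  (forall j, (msize (G j) <= (e j).+1)%N) -> (msize F <= d.+1)%N ->
  0 < L -> 0 <= Lam -> e ord0 = 1%N ->
  G ord0 = mpolyC n L - \sum_(i < n) mpolyX R (mnm1 i) ->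
  exists c0 kappa : R, [/\ 1 <= c0, 0 < kappa &
    forall lam delta eta : R, `|lam| <= Lam -> 0 < delta <= 1 -> 0 < eta <= 1 ->
    (forall y : 'I_n -> R, (forall i, 0 <= y i) ->
      (forall j, - delta <= meval y (G j)) -> meval y F <= lam - eta) ->
    forall v, std_simplex v ->
      kappa * eta <= lifted d F lam v + c0 / delta ^+ 2 * penalty e G v].
Proof.
move=> Ge Fd L0 Lam0 e0 G0.
have [MF hF] := bounded_lipschitz_homogenize d F.
have MF0 := bounded_lipschitz_ge0 hF.
pose u0 : R := (2 * (L + 1))^-1.
have u0_gt0 : 0 < u0 by rewrite invr_gt0 mulr_gt0 // addr_gt0.
have u0_le1 : u0 <= 1 by rewrite invf_le1; lra.
(* w bounds u ^+ e j from below for every j, whenever u0 <= u <= 1. *)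
pose E := (\sum_j e j)%N.
pose w := u0 ^+ E.
have w_gt0 : 0 < w by rewrite exprn_gt0.
have w_le1 : w <= 1 by rewrite exprn_ile1 // ltW.
pose Mh := Lam + MF + 1.
have Mh1 : 1 <= Mh by rewrite /Mh; lra.
have w2 : 1 <= (w ^+ 2)^-1 by rewrite invf_ge1 ?exprn_gt0 // exprn_ile1 // ltW.
pose c0 := 4 * Mh * (w ^+ 2)^-1.
have c0_ge : 4 * Mh <= c0 by rewrite /c0 ler_peMr //; lra.
exists c0, (u0 ^+ d); split; [by lra|by rewrite exprn_gt0|].
move=> lam delta eta lamL /andP[d0 d1] /andP[eta0 eta1] sup_le v sv.
have [v0 v1] := sv.
pose u := slack v.
have u_ge0 : 0 <= u by rewrite subr_ge0.
have u_le1 : u <= 1 by rewrite gerBl sumr_ge0.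
have kappa_le1 : u0 ^+ d * eta <= 1.
  by rewrite mulr_ile1 ?exprn_ile1 ?exprn_ge0 // ltW.
have delta2 : 0 < delta ^+ 2 by rewrite exprn_gt0.
have delta2_le1 : delta ^+ 2 <= 1 by rewrite exprn_ile1 // ltW.
have low : - (Lam + MF) <= lifted d F lam v.
  have ud : 0 <= u ^+ d <= 1 by rewrite exprn_ge0 // exprn_ile1.
  have : `|lam * u ^+ d| <= Lam.
    rewrite normrM -[X in _ <= X]mulr1 ler_pM //.
    by case/andP: ud => ud0; rewrite ger0_norm.
  case: hF => /(_ v sv); rewrite /lifted -/u !ler_norml => /andP[_ h1] _ /andP[h2 _]; lra.
have one_violation j t : 0 <= t -> homogenize (e j) (G j) v <= - t ->
    t ^+ 2 <= penalty e G v.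
  move=> t0 hj; rewrite /penalty (bigD1 j) //= -[X in X <= _]addr0 lerD //.
    by rewrite lerXn2r ?nnegrE ?le_max ?lexx // lerNr hj orbT.
  by rewrite sumr_ge0 // => i _; rewrite sqr_ge0.
have enough t : 4 * Mh * (w ^+ 2)^-1 / delta ^+ 2 * t ^+ 2 >= Mh -> t ^+ 2 <= penalty e G v ->
    u0 ^+ d * eta <= lifted d F lam v + c0 / delta ^+ 2 * penalty e G v.
  move=> h1 h2; have : Mh <= c0 / delta ^+ 2 * penalty e G v.
    apply: (le_trans h1); rewrite ler_wpM2l // divr_ge0 //; last exact: ltW.
    by apply: le_trans c0_ge; lra.
  by move=> h3; rewrite /Mh in h3; lra.
have [u_small|u_large] := ltP u u0.
  have hom0 : homogenize (e ord0) (G ord0) v <= - 2^-1.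
    rewrite e0 G0 homogenize_affine -/u lerBlDr.
    have h : (L + 1) * u0 = 2^-1 by rewrite /u0; field; rewrite gt_eqF //; lra.
    have : (L + 1) * u <= (L + 1) * u0 by rewrite ler_wpM2l ?ltW //; lra.
    lra.
  apply: (enough 2^-1); last by apply: (one_violation ord0).
  have -> : 4 * Mh / w ^+ 2 / delta ^+ 2 * 2^-1 ^+ 2 = Mh * ((w ^+ 2)^-1 * (delta ^+ 2)^-1).
    by field; rewrite !gt_eqF.
  rewrite ler_peMr //; first by apply: le_trans Mh1.
  by rewrite -[X in X <= _]mulr1 ler_pM // invf_ge1.
have u_gt0 : 0 < u by exact: lt_le_trans u_large.
have [|all_ok] := boolP [exists j, homogenize (e j) (G j) v < - (delta * w)].
  move=> /existsP[j /ltW hj]; apply: (enough (delta * w)); last first.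
    by apply: (one_violation j) => //; rewrite mulr_ge0 ?ltW.
  rewrite exprMn.
  have -> : 4 * Mh / w ^+ 2 / delta ^+ 2 * (delta ^+ 2 * w ^+ 2) = 4 * Mh.
    by field; rewrite !gt_eqF.
  lra.
pose y i := v i / u.
have y_ge0 i : 0 <= y i by rewrite divr_ge0.
have uw j : w <= u ^+ e j.
  apply: (@le_trans _ _ (u0 ^+ e j)); last by rewrite lerXn2r ?nnegrE // ltW.
  by rewrite /w /E (bigD1 j) //= exprD ler_piMr ?exprn_ge0 ?exprn_ile1 // ltW.
have Gy j : - delta <= meval y (G j).
  move/existsPn: all_ok => /(_ j); rewrite -leNgt homogenize_meval ?gt_eqF // -/u -/y => h.
  have ue : 0 < u ^+ e j by rewrite exprn_gt0.
  rewrite -(ler_pM2l ue) (le_trans _ h) // mulrN lerN2 mulrC ler_wpM2r ?uw //.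
  exact: ltW.
have Fy := sup_le y y_ge0 Gy.
have -> : lifted d F lam v = u ^+ d * (lam - meval y F).
  by rewrite /lifted homogenize_meval ?gt_eqF // -/u mulrBr [lam * _]mulrC.
rewrite -[X in X <= _]addr0 lerD //.
  rewrite ler_pM ?exprn_ge0 ?(ltW u0_gt0) ?(ltW eta0) //; last by lra.
  by rewrite lerXn2r ?nnegrE // ltW.
rewrite mulr_ge0 //; last by apply: sumr_ge0 => j _; rewrite sqr_ge0.
rewrite divr_ge0 //; last exact: ltW.
by apply: le_trans c0_ge; lra.
Qed.

(** [polya_certificate] applies to the bound of [penalty_lower_bound], with
    C = c0 / delta^2 and mu = kappa * eta. *)
Lemma orthant_certificate_of_gap (R : realType) (n m d : nat) (e : 'I_m.+1 -> nat)
    (G : 'I_m.+1 -> mpoly n R) (F : mpoly n R) (L Lam : R) :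
  (forall j, (msize (G j) <= (e j).+1)%N) -> (msize F <= d.+1)%N ->
  0 < L -> 0 <= Lam -> e ord0 = 1%N ->
  G ord0 = mpolyC n L - \sum_(i < n) mpolyX R (mnm1 i) ->
  exists2 K : R, 0 < K & forall (lam delta eta : R) (k : nat),
    `|lam| <= Lam -> 0 < delta <= 1 -> 0 < eta <= 1 ->
    (forall y : 'I_n -> R, (forall i, 0 <= y i) ->
      (forall j, - delta <= meval y (G j)) -> meval y F <= lam - eta) ->
    K <= k%:R * (delta ^+ 2 * eta) ->
    orthant_certificate G F d k lam.
Proof.
move=> Ge Fd L0 Lam0 e0 G0.
have [K1 K10 cert] := polya_certificate Ge Fd Lam0.
have [c0 [kappa [c01 kappa0 low]]] := penalty_lower_bound Ge Fd L0 Lam0 e0 G0.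
pose E := (\sum_j 2 * e j)%N.
exists (K1 * c0 / kappa + E%:R + 1) => [|lam delta eta k lamL delta01 eta01 sup_le Kk].
  by rewrite ltr_wpDl // addr_ge0 // divr_ge0 ?mulr_ge0 ?(ltW kappa0) ?(le_trans _ c01).
have /andP[delta0 delta1] := delta01; have /andP[eta0 eta1] := eta01.
have d2 : 0 < delta ^+ 2 by rewrite exprn_gt0.
have d2_le1 : delta ^+ 2 <= 1 by rewrite exprn_ile1 // ltW.
have part0 : 0 <= K1 * c0 / kappa.
  by rewrite divr_ge0 ?mulr_ge0 ?(ltW kappa0) ?(le_trans _ c01).
apply: (cert (c0 / delta ^+ 2) (kappa * eta) lam k) => //.
- by rewrite ler_pdivlMr // mul1r (le_trans d2_le1).
- exact: low.
- move=> j; rewrite -(ler_nat R); apply: (@le_trans _ _ E%:R).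
    by rewrite ler_nat /E (bigD1 j) //= leq_addr.
  apply: (@le_trans _ _ (K1 * c0 / kappa + E%:R + 1)); first lra.
  by apply: (le_trans Kk); rewrite ler_piMr // mulr_ile1 // ltW.
rewrite mulrA ler_pdivrMr //.
have : K1 * c0 / kappa <= k.+1%:R * (delta ^+ 2 * eta).
  apply: (@le_trans _ _ (K1 * c0 / kappa + E%:R + 1)); first by rewrite -addrA lerDl.
  apply: (le_trans Kk); rewrite ler_wpM2r ?ler_nat // mulr_ge0 // ltW //.
rewrite ler_pdivrMr // => /le_trans; apply.
by rewrite le_eqVlt; apply/orP; left; apply/eqP; ring.
Qed.

(** * Certificates at level zero *)

Lemma msizeM_bound (R : realType) (n a b : nat) (p q : mpoly n R) :
  (msize p <= a.+1)%N -> (msize q <= b.+1)%N -> (msize (p * q) <= (a + b).+1)%N.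
Proof.
move=> pa qb; rewrite msizeE; apply/bigmax_leqP_seq => m /msuppM_le mpq _.
have /allpairsP[[m1 m2] [/= m1p m2q ->]] := mpq.
rewrite ltnS mdegD leq_add //.
  by rewrite -ltnS (leq_trans (msize_mdeg_lt m1p)).
by rewrite -ltnS (leq_trans (msize_mdeg_lt m2q)).
Qed.

Lemma mcoeffM_ge0 (R : realType) (n : nat) (p q : mpoly n R) :
  (forall m, 0 <= mcoeff m p) -> (forall m, 0 <= mcoeff m q) ->
  forall m, 0 <= mcoeff m (p * q).
Proof. by move=> p0 q0 m; rewrite mcoeffM sumr_ge0 // => i _; rewrite mulr_ge0. Qed.

Lemma mcoeff_simplex_poly_ge0 (R : realType) (n : nat) (m : multinom n) :
  0 <= mcoeff m (simplex_poly R n).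
Proof. by have := multinomial_ge0 R 1 m; rewrite /multinomial expr1. Qed.

Lemma msize_sumX (R : realType) (n : nat) (P : pred 'I_n) :
  (msize (\sum_(i < n | P i) mpolyX R (mnm1 i)) <= 2)%N.
Proof.
apply: (leq_trans (mmeasure_sum _ _ _ _)).
by apply/bigmax_leqP_seq => i _ _; rewrite msizeX mdeg1.
Qed.

Lemma msize_simplex_poly (R : realType) (n : nat) : (msize (simplex_poly R n) <= 2)%N.
Proof.
by rewrite (leq_trans (msizeD_le _ _)) // geq_max msize1 msize_sumX.
Qed.

Lemma msize_ball_poly (R : realType) (n : nat) (L : R) :
  (msize (mpolyC n L - \sum_(i < n) mpolyX R (mnm1 i)) <= 2)%N.
Proof.
rewrite (leq_trans (msizeD_le _ _)) // geq_max msizeN msize_sumX andbT.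
by rewrite msizeC; case: (_ == _).
Qed.

(** Multiply the certificate by 1 + y_1 + ... + y_n. *)
Lemma orthant_certificate_up (R : realType) (n m : nat) (G : 'I_m -> mpoly n R)
    (F : mpoly n R) (d k : nat) (lam : R) :
  orthant_certificate G F d k lam -> orthant_certificate G F d k.+1 lam.
Proof.
move=> [sigma [r [s0 r0 sd rd certE]]].
have up p : (msize p <= (k + d).+1)%N ->
    (msize (simplex_poly R n * p) <= (k.+1 + d).+1)%N.
  by move=> /(msizeM_bound (msize_simplex_poly R n)).
exists (fun j => simplex_poly R n * sigma j), (simplex_poly R n * r); split.
- by move=> j; apply: mcoeffM_ge0 => //; exact: mcoeff_simplex_poly_ge0.
- by apply: mcoeffM_ge0 => //; exact: mcoeff_simplex_poly_ge0.
- by move=> j; rewrite -mulrA; exact: up.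
- exact: up.
rewrite exprS -mulrA certE mulrDr mulr_sumr; congr (_ + _).
by apply: eq_bigr => j _; rewrite mulrA.
Qed.

(** A trivial bound on F: with T = y_1 + ... + y_n, it suffices to write
    lam - y^a = s (L - T) + r with s and r nonnegative, for each monomial y^a.  By
    induction on a, if lam - y^b = s (L - T) + r then
    lam L - y_i y^b = (y_i s + lam) (L - T) + (y_i r + lam (T - y_i)).
    This gives a finite upper bound for all levels of the hierarchy, including
    those to which Polya's argument does not apply. *)
Lemma orthant_certificate0 (R : realType) (n m d : nat) (G : 'I_m.+1 -> mpoly n R)
    (F : mpoly n R) (L : R) :
  (msize F <= d.+1)%N -> 0 < L ->
  G ord0 = mpolyC n L - \sum_(i < n) mpolyX R (mnm1 i) ->
  exists lam, orthant_certificate G F d 0 lam.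
Proof.
move=> Fd L0 G0.
pose bounded q := exists (lam : R) (s r : mpoly n R),
  [/\ 0 <= lam, (forall b, 0 <= mcoeff b s) /\ (forall b, 0 <= mcoeff b r),
      (msize s <= d)%N, (msize r <= d.+1)%N & mpolyC n lam - q = s * G ord0 + r].
have mono_bound (a : multinom n) : (mdeg a <= d)%N ->
    exists (lam : R) (s r : mpoly n R),
  [/\ 0 <= lam, (forall b, 0 <= mcoeff b s) /\ (forall b, 0 <= mcoeff b r),
      (msize s <= mdeg a)%N, (msize r <= (mdeg a).+1)%N &
      mpolyC n lam - mpolyX R a = s * G ord0 + r].
  move: {2}(mdeg a) (erefl (mdeg a)) => h.
  elim: h a => [|h IH] a aE ad.
    exists 1, 0, 0; split; rewrite ?msize0 //; first by split=> b; rewrite mcoeff0.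
    move/eqP: aE; rewrite mdeg_eq0 => /eqP ->.
    by rewrite mpolyX0 mpolyC1 subrr mul0r addr0.
  have [i ai] : exists i, a i != 0%N.
    apply/existsP; apply: contra_eqT (aE) => /existsPn a0.
    suff -> : a = mnm0 by rewrite mdeg0.
    by apply/mnmP => i; rewrite mnm0E; apply/eqP; have := a0 i; rewrite negbK.
  have [b bE] : exists b, a = mnm_add (mnm1 i) b.
    by exists (mnm_sub a (mnm1 i)); rewrite addmC submK ?lep1mP.
  have bh : mdeg b = h by move: aE; rewrite bE mdegD mdeg1 => -[].
  have [|lam [s [r [lam0 [s0 r0] sb rb E]]]] := IH b bh.
    by rewrite bh ltnW // -aE.
  pose X := mpolyX R (mnm1 i).
  have X0 c : 0 <= mcoeff c X by rewrite mcoeffX.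
  have X2 : (msize X <= 2)%N by rewrite msizeX mdeg1.
  have lamX0 c : 0 <= mcoeff c (mpolyC n lam) by rewrite mcoeffC mulr_ge0.
  pose T' := \sum_(j < n | j != i) mpolyX R (mnm1 j).
  exists (lam * L), (X * s + mpolyC n lam), (X * r + mpolyC n lam * T'); split.
  - by rewrite mulr_ge0 // ltW.
  - split=> c; rewrite mcoeffD addr_ge0 ?mcoeffM_ge0 // => c'.
    by rewrite raddf_sum sumr_ge0 // => j _; rewrite /= mcoeffX.
  - rewrite (leq_trans (msizeD_le _ _)) // geq_max aE msizeC; apply/andP; split.
      move: sb; rewrite bh; case: (h) => [|h'].
        by rewrite leqn0 msize_poly_eq0 => /eqP ->; rewrite mulr0 msize0.
      by move=> /(msizeM_bound X2).
    by case: (_ == _).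
  - rewrite (leq_trans (msizeD_le _ _)) // geq_max aE; apply/andP; split.
      by move: rb; rewrite bh => /(msizeM_bound X2).
    rewrite mul_mpolyC (leq_trans (msizeZ_le _ _)) // (leq_trans (msize_sumX _ _)) //.
  rewrite bE mpolyXD -/X mpolyCM.
  have -> : mpolyX R b = mpolyC n lam - (s * G ord0 + r) by rewrite -E subKr.
  have -> : G ord0 = mpolyC n L - X - T'.
    by rewrite G0 (bigD1 i) //= opprD addrA.
  by ring.
have [lam [s [r [lam0 [s0 r0] sd rd E]]]] : bounded F.
  rewrite [F]mpolyE big_seq; apply: (@big_ind _ bounded) => [|p q|a aF].
  - exists 0, 0, 0; split; rewrite ?msize0 //; first by split=> b; rewrite mcoeff0.
    by rewrite mpolyC0 subrr mul0r addr0.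
  - move=> [l [s [r [l0 [s0 r0] sd rd E]]]] [l' [s' [r' [l0' [s0' r0'] sd' rd' E']]]].
    exists (l + l'), (s + s'), (r + r'); split.
    + exact: addr_ge0.
    + by split=> b; rewrite mcoeffD addr_ge0.
    + by rewrite (leq_trans (msizeD_le _ _)) // geq_max sd.
    + by rewrite (leq_trans (msizeD_le _ _)) // geq_max rd.
    by rewrite mpolyCD opprD addrACA E E' mulrDl addrACA.
  - have ad : (mdeg a <= d)%N by rewrite -ltnS (leq_trans (msize_mdeg_lt aF)).
    have [c0|c0] := leP 0 (mcoeff a F).
      have [l [s [r [l0 [s0 r0] sd rd E]]]] := mono_bound a ad.
      exists (mcoeff a F * l), (mcoeff a F *: s), (mcoeff a F *: r); split.
      + exact: mulr_ge0.
      + by split=> b; rewrite mcoeffZ mulr_ge0.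
      + by rewrite (leq_trans (msizeZ_le _ _)) // (leq_trans sd).
      + by rewrite (leq_trans (msizeZ_le _ _)) // (leq_trans rd).
      by rewrite mpolyCM mul_mpolyC -scalerBr E scalerDr scalerAl.
    exists 0, 0, (- mcoeff a F *: mpolyX R a); split; rewrite ?msize0 //.
    + split=> b; first by rewrite mcoeff0.
      by rewrite mcoeffZ mcoeffX mulr_ge0 // oppr_ge0 ltW.
    + by rewrite (leq_trans (msizeZ_le _ _)) // msizeX ltnS.
    by rewrite mpolyC0 sub0r mul0r add0r scaleNr.
exists lam, (fun j => if j == ord0 then s else 0), r; split=> //.
- by move=> j b; case: eqP => _ //; rewrite mcoeff0.
- move=> j; case: eqP => [->|_]; last by rewrite mul0r msize0.
  rewrite add0n; case: (d) sd => [|d'] sd.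
    by move: sd; rewrite leqn0 msize_poly_eq0 => /eqP ->; rewrite mul0r msize0.
  rewrite -addn1; apply: msizeM_bound => //.
  by rewrite G0 msize_ball_poly.
rewrite expr0 mul1r E (bigD1 ord0) //= big1 ?addr0 // => j /negPf ->.
by rewrite mul0r.
Qed.

(** * Quantifier elimination and one-variable growth *)

Definition term_definable (R : realType) (F : seq R -> R) : Prop :=
  exists t : GRing.term R, forall e, GRing.eval e t = F e.

(** Definability by a first-order formula in the language of ordered fields with
    parameters, the free variables being the entries of a sequence. *)
Definition definable (R : realType) (P : seq R -> Prop) : Prop :=
  exists phi : ord.formula R, forall e, ord.holds e phi <-> P e.

Lemma term_definable_meval (R : realType) (n : nat) (p : mpoly n R)
    (h : 'I_n -> nat) :
  term_definable (fun e => meval (fun i => e`_(h i)) p).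
Proof.
pose mon (m : multinom n) : GRing.term R :=
  foldr (fun i t => GRing.Mul (GRing.Exp (GRing.Var R (h i)) (m i)) t)
        (GRing.Const 1) (enum 'I_n).
exists (foldr (fun m t => GRing.Add (GRing.Mul (GRing.Const (mcoeff m p)) (mon m)) t)
          (GRing.Const 0) (msupp p)) => e.
rewrite mevalE; elim: (msupp p : seq _) => [|m s IH] /=; first by rewrite big_nil.
rewrite big_cons IH; congr (_ * _ + _).
rewrite /mon -[index_enum _]enumT; elim: (enum _) => [|i l IHl] /=; first by rewrite big_nil.
by rewrite big_cons IHl.
Qed.

Lemma definable_le (R : realType) (F G : seq R -> R) :
  term_definable F -> term_definable G -> definable (fun e => F e <= G e).
Proof.
by move=> [t tF] [u uG]; exists (ord.Le t u) => e /=; rewrite tF uG.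
Qed.

Lemma definable_and (R : realType) (P Q : seq R -> Prop) :
  definable P -> definable Q -> definable (fun e => P e /\ Q e).
Proof.
move=> [a aP] [b bQ]; exists (ord.And a b) => e /=.
by rewrite aP bQ.
Qed.

Lemma definable_forall (R : realType) (I : finType) (P : I -> seq R -> Prop) :
  (forall i, definable (P i)) -> definable (fun e => forall i, P i e).
Proof.
move=> /boolp.choice[phi phiP].
exists (foldr (fun i => ord.And (phi i)) (@ord.Bool R true) (enum I)) => e.
have -> : (forall i, P i e) <-> (forall i, i \in enum I -> P i e).
  by split=> h i => [_|]; [exact: h|apply: h; rewrite mem_enum].
elim: (enum I) => [|i s IH] /=; first by split.
rewrite phiP IH; split=> [[Pi Ps] j|Ps].
  by rewrite inE => /orP[/eqP->//|]; exact: Ps.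
by split=> [|j js]; apply: Ps; rewrite inE ?eqxx ?js ?orbT.
Qed.

(** The block of quantifiers is expressed by a second environment that agrees with
    e outside s, so that no iterated update of e appears. *)
Lemma definable_exists (R : realType) (P : seq R -> Prop) (s : seq nat) :
  definable P ->
  definable (fun e => exists e', (forall l, l \notin s -> e'`_l = e`_l) /\ P e').
Proof.
move=> [phi phiP]; elim: s => [|i s [psi IH]].
  exists phi => e; rewrite phiP; split=> [Pe|[e' [ee' /phiP]]]; first by exists e.
  by rewrite -phiP; apply: ord.eq_holds => l; rewrite ee'.
exists (ord.Exists i psi) => e /=; split.
  move=> [v] /IH [e' [e'E Pe']]; exists e'; split=> // l.
  rewrite inE negb_or => /andP[li ls]; rewrite e'E // nth_set_nth /=.
  by rewrite (negPf li).
move=> [e' [e'E Pe']]; exists e'`_i; apply/IH; exists e'; split=> // l ls.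
rewrite nth_set_nth /=; case: eqP => [->//|/eqP li].
by rewrite e'E // inE negb_or li.
Qed.

Lemma rterm_bipoly (R : realType) (t : GRing.term R) : GRing.rterm t ->
  exists p : {poly {poly R}}, forall a b, GRing.eval [:: a; b] t = p.[a%:P].[b].
Proof.
elim: t => //=.
- case=> [|[|i]] _.
  + by exists 'X => a b; rewrite hornerX hornerC.
  + by exists ('X%:P) => a b; rewrite hornerC hornerX.
  + by exists 0 => a b; rewrite /= nth_nil !horner0.
- by move=> x _; exists x%:P%:P => a b; rewrite !hornerC.
- by move=> k _; exists k%:R => a b; rewrite -!polyC_natr !hornerC.
- move=> t IHt u IHu /andP[/IHt[p pE] /IHu[q qE]].
  by exists (p + q) => a b; rewrite pE qE !hornerD.
- by move=> t IHt /IHt[p pE]; exists (- p) => a b; rewrite pE !hornerN.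
- by move=> t IHt k /IHt[p pE]; exists (p *+ k) => a b; rewrite pE !hornerMn.
- move=> t IHt u IHu /andP[/IHt[p pE] /IHu[q qE]].
  by exists (p * q) => a b; rewrite pE qE !hornerM.
- by move=> t IHt k /IHt[p pE]; exists (p ^+ k) => a b; rewrite pE !horner_exp.
Qed.

(** Away from the zero set of the product p of all nontrivial polynomials that
    occur in the formula, the sign of each atom is locally constant in the second
    variable. *)
Lemma qf_locally_constant (R : realType) (phi : ord.formula R) :
  ord.qf_form phi -> ord.rformula phi ->
  exists2 p : {poly {poly R}}, p != 0 & forall a b : R, p.[a%:P].[b] != 0 ->
    \forall b' \near b,
      ord.qf_eval [:: a; b'] phi = ord.qf_eval [:: a; b] phi.
Proof.
have atom (t u : GRing.term R) : GRing.rterm t && GRing.rterm u ->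
  exists2 p : {poly {poly R}}, p != 0 & forall a b : R, p.[a%:P].[b] != 0 ->
    \forall b' \near b,
   ((GRing.eval [:: a; b'] t < GRing.eval [:: a; b'] u) =
    (GRing.eval [:: a; b] t < GRing.eval [:: a; b] u)) /\
   ((GRing.eval [:: a; b'] u < GRing.eval [:: a; b'] t) =
    (GRing.eval [:: a; b] u < GRing.eval [:: a; b] t)).
  move=> /andP[/rterm_bipoly[p pE] /rterm_bipoly[q qE]].
  have [eq_qp|neq_qp] := eqVneq q p.
    exists 1; first exact: oner_neq0.
    by move=> a b _; near=> b'; rewrite !pE !qE eq_qp !ltxx.
  exists (q - p) => [|a b r0]; first by rewrite subr_eq0.
  have cr : (q - p).[a%:P].[b'] @[b' --> b] --> (q - p).[a%:P].[b].
    exact: continuous_horner.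
  have ltE b' : ((GRing.eval [:: a; b'] t < GRing.eval [:: a; b'] u) =
      (0 < (q - p).[a%:P].[b'])) * ((GRing.eval [:: a; b'] u < GRing.eval [:: a; b'] t) =
      ((q - p).[a%:P].[b'] < 0)).
    by rewrite pE qE !hornerD !hornerN subr_gt0 subr_lt0.
  have [r_gt0|r_lt0] : 0 < (q - p).[a%:P].[b] \/ (q - p).[a%:P].[b] < 0.
      by apply/orP; rewrite orbC -neq_lt.
  - have r'_gt0 : \forall b' \near b, 0 < (q - p).[a%:P].[b'] := cvgr_gt _ cr _ r_gt0.
    near=> b'; rewrite !ltE.
    have r' : 0 < (q - p).[a%:P].[b'] by near: b'; exact: r'_gt0.
    by rewrite r' r_gt0; split=> //; rewrite (lt_gtF r') lt_gtF.
  - have r'_lt0 : \forall b' \near b, (q - p).[a%:P].[b'] < 0 := cvgr_lt _ cr _ r_lt0.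
    near=> b'; rewrite !ltE.
    have r' : (q - p).[a%:P].[b'] < 0 by near: b'; exact: r'_lt0.
    by rewrite r' r_lt0; split=> //; rewrite (lt_gtF r') lt_gtF.
have two (f1 f2 : ord.formula R) (c : bool -> bool -> bool) :
  (exists2 p : {poly {poly R}}, p != 0 & forall a b : R, p.[a%:P].[b] != 0 ->
    \forall b' \near b, ord.qf_eval [:: a; b'] f1 = ord.qf_eval [:: a; b] f1) ->
  (exists2 p : {poly {poly R}}, p != 0 & forall a b : R, p.[a%:P].[b] != 0 ->
    \forall b' \near b, ord.qf_eval [:: a; b'] f2 = ord.qf_eval [:: a; b] f2) ->
  exists2 p : {poly {poly R}}, p != 0 & forall a b : R, p.[a%:P].[b] != 0 ->
    \forall b' \near b,
      c (ord.qf_eval [:: a; b'] f1) (ord.qf_eval [:: a; b'] f2) =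
      c (ord.qf_eval [:: a; b] f1) (ord.qf_eval [:: a; b] f2).
  move=> [p p0 pP] [q q0 qP]; exists (p * q) => [|a b]; first exact: mulf_neq0.
  rewrite !hornerM mulf_eq0 negb_or => /andP[/pP np /qP nq].
  by near do congr (c _ _).
elim: phi => //=.
- move=> c _ _; exists 1; first exact: oner_neq0.
  by move=> a b _; near=> b1.
- move=> t u _ /atom[p p0 pP]; exists p => // a b /pP; apply: filterS => b' [h1 h2].
  by rewrite !eq_le !leNgt h1 h2.
- by move=> t u _ /atom[p p0 pP]; exists p => // a b /pP; apply: filterS => b' [].
- move=> t u _ /atom[p p0 pP]; exists p => // a b /pP; apply: filterS => b' [h1 h2].
  by rewrite !leNgt h2.
- by move=> f1 I1 f2 I2 /andP[/I1 J1 /I2 J2] /andP[/J1 + /J2]; exact: two.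
- by move=> f1 I1 f2 I2 /andP[/I1 J1 /I2 J2] /andP[/J1 + /J2]; exact: two.
- by move=> f1 I1 f2 I2 /andP[/I1 J1 /I2 J2] /andP[/J1 + /J2]; exact: (two _ _ implb).
- move=> f1 I1 /I1 J /J[p p0 pP]; exists p => // a b /pP; apply: filterS => b' h.
  by rewrite h.
Unshelve. all: by end_near. Qed.

Lemma definable_locally_constant (R : realType) (P : seq R -> Prop) :
  definable P ->
  exists2 p : {poly {poly R}}, p != 0 & forall a b : R, p.[a%:P].[b] != 0 ->
    \forall b' \near b, P [:: a; b'] <-> P [:: a; b].
Proof.
move=> [phi phiP].
have rphi := ord.to_rform_rformula phi.
have /andP[qf rf] := ord.quantifier_elim_wf (@qe_rcf.wf_QE_wproj R) rphi.
have elimP e := ord.quantifier_elim_rformP (@qe_rcf.wf_QE_wproj R)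
  (@qe_rcf.valid_QE_wproj R) e rphi.
set psi := ord.quantifier_elim _ _ in qf rf elimP.
have PE e : P e <-> ord.qf_eval e psi.
  by rewrite -phiP -ord.to_rformP; apply: rwP; exact: elimP.
have [p p0 pP] := qf_locally_constant qf rf.
exists p => // a b /pP psi_cst; near=> b'; rewrite !PE.
suff -> : ord.qf_eval [:: a; b'] psi = ord.qf_eval [:: a; b] psi by [].
by near: b'; exact: psi_cst.
Unshelve. all: by end_near. Qed.

Lemma bipoly_bounded (R : realType) (p : {poly {poly R}}) (B : R) :
  exists2 M, 0 <= M & forall a b, `|a| <= B -> `|b| <= B -> `|p.[a%:P].[b]| <= M.
Proof.
have unib (q : {poly R}) : exists2 M, 0 <= M & forall b, `|b| <= B -> `|q.[b]| <= M.
  elim/poly_ind: q => [|q c [M M0 IH]].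
    by exists 0 => // b _; rewrite horner0 normr0.
  exists (M * `|B| + `|c|) => [|b bB].
    by rewrite addr_ge0 ?mulr_ge0.
  rewrite hornerMXaddC (le_trans (ler_normD _ _)) // lerD2r normrM ler_pM //.
    exact: IH.
  by rewrite (le_trans bB) // ler_norm.
elim/poly_ind: p => [|p c [M M0 IH]].
  by exists 0 => // a b _ _; rewrite !horner0 normr0.
have [N N0 cN] := unib c.
exists (M * `|B| + N) => [|a b aB bB].
  by rewrite addr_ge0 ?mulr_ge0.
rewrite hornerMXaddC hornerD hornerM hornerC (le_trans (ler_normD _ _)) //.
rewrite lerD ?cN // normrM ler_pM ?IH //.
by rewrite (le_trans aB) // ler_norm.
Qed.

(** The Lojasiewicz inequality for one function of one variable: an algebraic
    function that tends to l at 0+ does so at a polynomial rate.  Write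
    P(a, b) = a^v Q(a, b) with Q(0, b) nonzero, and Q(0, b) = r(b) (b - l)^q with
    r(l) nonzero.  Then Q(a, phi(a)) = 0 gives
    r(phi(a)) (phi(a) - l)^q = - a Q1(a, phi(a)) with Q1 bounded. *)
Lemma algebraic_rate (R : realType) (P : {poly {poly R}}) (phi : R -> R) (l d0 : R) :
  P != 0 -> 0 < d0 ->
  (forall a : R, 0 < a <= d0 -> P.[a%:P].[phi a] = 0) ->
  (forall e : R, 0 < e ->
    exists2 d : R, 0 < d & forall a : R, 0 < a <= d -> `|phi a - l| <= e) ->
  exists (q : nat) (C d : R), [/\ 0 < C, 0 < d &
    forall a : R, 0 < a <= d -> `|phi a - l| ^+ q.+1 <= C * a].
Proof.
move=> P0 d0_gt0 Pphi phil.
have [v [Q]] := multiplicity_XsubC P (0%:P : {poly R}).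
rewrite P0 /= subr0 => Q0 PE.
have [q [r]] := multiplicity_XsubC Q.[0] l.
rewrite (Q0 : Q.[0] != 0) /= => rl QE.
have /factor_theorem[Q1 Q1E] : root (Q - Q.[0]%:P) 0.
  by rewrite /root !hornerE subrr.
have [M M0 Q1M] := bipoly_bounded Q1 (1 + `|l|).
have cr : r.[b] @[b --> l] --> r.[l] by exact: continuous_horner.
have rl0 : 0 < `|r.[l]| / 2 by rewrite divr_gt0 // normr_gt0.
have [e /= e0 er] : exists2 e, 0 < e & forall b, `|b - l| <= e -> `|r.[l]| / 2 <= `|r.[b]|.
  have : \forall b \near l, `|r.[l]| / 2 < `|r.[b]|.
    have cnr : `|r.[b]| @[b --> l] --> `|r.[l]| by exact: cvg_norm.
    apply: (cvgr_gt _ cnr).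
    by rewrite ltr_pdivrMr // mulr_natr mulr2n ltrDl normr_gt0.
  move=> /nbhs_ballP[e /= e0 eb]; exists (e / 2); first by rewrite divr_gt0.
  move=> b bl; apply/ltW/eb; rewrite /ball /= distrC (le_lt_trans bl) //.
  by rewrite ltr_pdivrMr // mulr_natr mulr2n ltrDl.
have [d d_gt0 dphi] := phil (Num.min e 1) (ltac:(by rewrite lt_min e0 ltr01)).
(* The exponent is q.+1 because q may be 0; M + 1 because M may be 0. *)
exists q, ((M + 1) / (`|r.[l]| / 2)), (Num.min d (Num.min d0 1)); split.
- by rewrite divr_gt0 // ltr_wpDl.
- by rewrite !lt_min d_gt0 d0_gt0 ltr01.
move=> a /andP[a0]; rewrite !le_min => /and3P[ad ad0 a1].
have := dphi a; rewrite a0 ad => /(_ isT); rewrite le_min => /andP[se s1].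
set s := phi a - l in se s1 *.
have rs : `|r.[l]| / 2 <= `|r.[phi a]| by apply: er.
have phiB : `|phi a| <= 1 + `|l|.
  by rewrite -[phi a](subrK l) (le_trans (ler_normD _ _)) // lerD2r.
have aB : `|a| <= 1 + `|l|.
  by rewrite gtr0_norm // (le_trans a1) // lerDl.
have Qz : Q.[a%:P].[phi a] = 0.
  have := Pphi a; rewrite a0 ad0 => /(_ isT); rewrite PE.
  rewrite hornerM horner_exp hornerX !hornerM horner_exp hornerC => /eqP.
  by rewrite mulf_eq0 expf_eq0 (gt_eqF a0) andbF orbF => /eqP.
have key : r.[phi a] * s ^+ q = - (Q1.[a%:P].[phi a] * a).
  apply/eqP; rewrite -subr_eq0 opprK -[X in _ == X]Qz.
  have -> : Q = Q.[0]%:P + Q1 * 'X by rewrite -(subr0 'X) -polyC0 -Q1E addrC subrK.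
  by rewrite {1}QE !hornerE.
have step : `|r.[l]| / 2 * `|s| ^+ q <= M * a.
  rewrite (@le_trans _ _ (`|r.[phi a]| * `|s| ^+ q)) ?ler_wpM2r //.
  rewrite -normrX -normrM key normrN normrM (gtr0_norm a0) ler_wpM2r ?(ltW a0) //.
  exact: Q1M.
rewrite mulrAC ler_pdivlMr //.
rewrite (@le_trans _ _ (M * a)) //; last by rewrite ler_wpM2r ?(ltW a0) ?lerDl.
apply: le_trans step; rewrite mulrC ler_wpM2l ?(ltW rl0) //.
by rewrite exprS ler_piMl ?exprn_ge0.
Qed.

(** * Relaxed feasible sets *)

Lemma continuous_sumr (R : realType) (T : topologicalType) (I : Type) (s : seq I)
    (F : I -> T -> R) :
  (forall i, continuous (F i)) -> continuous (fun x => \sum_(i <- s) F i x).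
Proof.
move=> cF; elim: s => [|i s IH].
  have -> : (fun x => \sum_(i <- [::]) F i x) = fun=> 0.
    by apply/boolp.funext => x; rewrite big_nil.
  exact: cst_continuous.
have -> : (fun x => \sum_(j <- i :: s) F j x) =
    (fun x => F i x + \sum_(j <- s) F j x).
  by apply/boolp.funext => x; rewrite big_cons.
by move=> x; apply: cvgD; [exact: cF|exact: IH].
Qed.

Lemma continuous_prodr (R : realType) (T : topologicalType) (I : Type) (s : seq I)
    (F : I -> T -> R) :
  (forall i, continuous (F i)) -> continuous (fun x => \prod_(i <- s) F i x).
Proof.
move=> cF; elim: s => [|i s IH].
  have -> : (fun x => \prod_(i <- [::]) F i x) = fun=> 1.
    by apply/boolp.funext => x; rewrite big_nil.
  exact: cst_continuous.
have -> : (fun x => \prod_(j <- i :: s) F j x) =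
    (fun x => F i x * \prod_(j <- s) F j x).
  by apply/boolp.funext => x; rewrite big_cons.
by move=> x; apply: cvgM; [exact: cF|exact: IH].
Qed.

Lemma continuous_mulr (R : realType) (T : topologicalType) (c : R) (F : T -> R) :
  continuous F -> continuous (fun x => c * F x).
Proof. by move=> cF x; apply: cvgM; [exact: cvg_cst|exact: cF]. Qed.

Lemma continuous_negpart (R : realType) (T : topologicalType) (F : T -> R) :
  continuous F -> continuous (fun x => Num.max 0 (- F x)).
Proof.
move=> cF x; apply: (@continuous_max R T (fun=> 0) (fun y => - F y)).
  exact: cst_continuous.
by apply: cvgN; exact: cF.
Qed.

(** Points are plain functions with the product topology, so that compactness is
    Tychonoff's theorem and n = 0 is not special. *)
Lemma continuous_meval (R : realType) (n : nat) (p : mpoly n R) :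
  continuous (fun x : {ptws 'I_n -> R} => meval x p).
Proof.
have -> : (fun x : {ptws 'I_n -> R} => meval x p) =
    fun x => \sum_(m <- msupp p) mcoeff m p * \prod_i x i ^+ m i.
  by apply/boolp.funext => x; rewrite mevalE.
refine (@continuous_sumr R {ptws 'I_n -> R} _ _ _ _) => m.
have cX : continuous (fun x : {ptws 'I_n -> R} => \prod_i x i ^+ m i).
  refine (@continuous_prodr R {ptws 'I_n -> R} _ _ _ _) => i y.
  apply: (@continuous_comp {ptws 'I_n -> R} R R (fun z => z i) (fun t => t ^+ m i)).
    exact: proj_continuous.
  exact: exprn_continuous.
exact: (@continuous_mulr R {ptws 'I_n -> R}).
Qed.

Definition relaxed_set (R : realType) (n m : nat) (g : 'I_m -> mpoly n R) (a : R) :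
    set ('I_n -> R) :=
  [set x | forall j, - a <= meval x (g j)].

(** By compactness: on the part of the box where lam <= f the total violation of
    the constraints is positive, hence bounded away from 0. *)
Lemma relaxed_upper_bound (R : realType) (n m : nat) (g : 'I_m -> mpoly n R)
    (f : mpoly n R) (B lam : R) :
  (forall x, relaxed_set g 1 x -> forall i, `|x i| <= B) ->
  (forall x, relaxed_set g 0 x -> meval x f < lam) ->
  exists a : R, [/\ 0 < a, a <= 1 & forall x, relaxed_set g a x -> meval x f < lam].
Proof.
move=> bounded f_lt.
pose box : set {ptws 'I_n -> R} := [set x | forall i, `[- B, B]%classic (x i)].
have cpt_box : compact box 
  by apply: (@tychonoff 'I_n (fun=> R) (fun=> `[- B, B]%classic)) => i; exact: segment_compact.
pose A := box `&` [set x | lam <= meval x f].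
have cptA : compact A.
  apply: compact_closedI => //.
  apply: (@preimage_closed _ _ (fun x : {ptws 'I_n -> R} => meval x f) [set y | lam <= y]).
    by move=> x _; exact: continuous_meval.
  exact: closed_ge.
pose viol (x : {ptws 'I_n -> R}) := \sum_j Num.max 0 (- meval x (g j)).
have cviol : continuous viol.
  refine (@continuous_sumr R {ptws 'I_n -> R} _ _ _ _) => j.
  apply: (@continuous_negpart R {ptws 'I_n -> R} (fun y => meval y (g j))).
  exact: continuous_meval.
have viol_ge0 x j : 0 <= Num.max 0 (- meval x (g j)) by rewrite le_max lexx.
have clA : closed (viol @` A).
  apply: compact_closed; first exact: Rhausdorff.
  apply: (@continuous_compact {ptws 'I_n -> R} R viol A) => //.
  exact: (@continuous_subspaceT {ptws 'I_n -> R} R).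
have viol0 : (~` (viol @` A)) 0.
  move=> -[x [_ /= lamf]] /eqP; rewrite psumr_eq0; last by move=> j _; exact: viol_ge0.
  move=> /allP viol0; have := f_lt x; rewrite ltNge lamf => /(_ _)/negP; apply=> //.
  move=> j; have /viol0 := mem_index_enum j.
  by rewrite /= oppr0 eq_le ge_max lexx /= oppr_le0 => /andP[].
have /(open_nbhs_nbhs)/nbhs_ballP[r /= r0 rP] : open_nbhs 0 (~` (viol @` A)).
  by split=> //; exact: closed_openC.
pose a := Num.min 1 (r / 2 / (m.+1)%:R).
have a_gt0 : 0 < a by rewrite lt_min ltr01 !divr_gt0.
exists a; split=> //; first by rewrite ge_min lexx.
move=> x xa; rewrite ltNge; apply/negP => lamf.
apply: (rP (viol x)); last first.
  exists x => //; split=> // i; rewrite /= in_itv /= -ler_norml.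
  by apply: bounded => j; apply: le_trans (xa j); rewrite lerN2 ge_min lexx.
have viol_ge : 0 <= viol x by apply: sumr_ge0 => j _; exact: viol_ge0.
rewrite /ball /= sub0r normrN ger0_norm //.
apply: (@le_lt_trans _ _ (\sum_(j < m) a)).
  by apply: ler_sum => j _; rewrite ge_max ltW //= lerNl.
rewrite sumr_const card_ord -mulr_natr.
apply: (@le_lt_trans _ _ (r / 2 / m.+1%:R * m%:R)).
  by rewrite ler_wpM2r // ge_min lexx orbT.
rewrite mulrAC ltr_pdivrMr ?ltr0n // ltr_pM //; last by rewrite ltr_nat.
  by rewrite divr_ge0 // ltW.
by rewrite ltr_pdivrMr // mulr_natr mulr2n ltrDl.
Qed.

Lemma definable_relaxed (R : realType) (n m : nat) (g : 'I_m -> mpoly n R)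
    (f : mpoly n R) :
  exists2 P : seq R -> Prop, definable P &
    forall a b, P [:: a; b] <-> exists2 x, relaxed_set g a x & b <= meval x f.
Proof.
pose h (i : 'I_n) := i.+2.
pose body (e : seq R) :=
  (forall j, - e`_0 <= meval (fun i => e`_(h i)) (g j)) /\
  e`_1 <= meval (fun i => e`_(h i)) f.
have body_def : definable body.
  apply: definable_and.
    apply: definable_forall => j; apply: definable_le.
      by exists (GRing.Opp (GRing.Var R 0)).
    exact: term_definable_meval.
  apply: definable_le; first by exists (GRing.Var R 1).
  exact: term_definable_meval.
exists (fun e => exists e' : seq R, (forall l, l \notin iota 2 n -> e'`_l = e`_l) /\ body e').
  exact: definable_exists.
move=> a b; split=> [[e [eE [eg ef]]]|[x xg xf]].
  have e0 : e`_0 = a by rewrite eE // mem_iota.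
  have e1 : e`_1 = b by rewrite eE // mem_iota.
  by rewrite e0 in eg; rewrite e1 in ef; exists (fun i => e`_(h i)).
exists (a :: b :: [seq x i | i <- enum 'I_n]).
have xE : (fun i : 'I_n => [seq x i | i <- enum 'I_n]`_i) = x.
  apply/funext => i; rewrite (nth_map i) ?size_enum_ord //.
  by congr x; apply: val_inj; rewrite /= nth_enum_ord.
split; last by split=> [j|] /=; rewrite xE.
move=> [|[|l]] //; rewrite mem_iota /= -[(2 + n)%N]/(n.+2) !ltnS -leqNgt => nl.
by rewrite nth_nil nth_default // size_map size_enum_ord.
Qed.

(** Let phi(a) be the supremum of f on the set relaxed by a.  By quantifier
    elimination phi satisfies a polynomial equation P(a, phi(a)) = 0, since
    b = phi(a) is the point where the truth of
    exists x, x relaxed-feasible and b <= f(x) changes.  As phi(a) tends to the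
    maximum l by compactness, [algebraic_rate] applies. *)
Lemma relaxed_rate (R : realType) (n m : nat) (g : 'I_m -> mpoly n R)
    (f : mpoly n R) (B l : R) :
  (forall x, relaxed_set g 1 x -> forall i, `|x i| <= B) ->
  (exists x, relaxed_set g 0 x) ->
  (forall x, relaxed_set g 0 x -> meval x f <= l) ->
  (forall u, (forall x, relaxed_set g 0 x -> meval x f <= u) -> l <= u) ->
  exists (q : nat) (C d : R), [/\ 0 < C, 0 < d &
    forall (a : R) x, 0 < a <= d -> relaxed_set g a x -> l <= meval x f ->
      (meval x f - l) ^+ q.+1 <= C * a].
Proof.
move=> bounded [x0 x0g] ub_l lub_l.
pose img a := [set meval x f | x in relaxed_set g a].
pose phi a := sup (img a).
have relax_mono a b x : a <= b -> relaxed_set g a x -> relaxed_set g b x.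
  by move=> ab xa j; apply: le_trans (xa j); rewrite lerN2.
have upper (e : R) : 0 < e -> exists2 d : R, 0 < d &
    forall a, a <= d -> forall x, relaxed_set g a x -> meval x f < l + e.
  move=> e0; have [|d [d0 _ dP]] := relaxed_upper_bound (f := f) (lam := l + e) bounded.
    by move=> x /ub_l /le_lt_trans; apply; rewrite ltrDl.
  by exists d => // a ad x /(relax_mono _ _ _ ad) /dP.
have [d0 d0_gt0 d0P] := upper 1 ltr01.
have img_sup a : 0 < a <= d0 -> has_sup (img a).
  move=> /andP[a0 ad]; split.
    by exists (meval x0 f), x0 => //; apply: relax_mono x0g; exact: ltW.
  by exists (l + 1) => _ [x xa <-]; apply/ltW/(d0P a).
have phi_ub a x : 0 < a <= d0 -> relaxed_set g a x -> meval x f <= phi a.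
  by move=> ad xa; apply: sup_upper_bound; [exact: img_sup|exists x].
have phi_ge a : 0 < a <= d0 -> l <= phi a.
  move=> ad; apply: lub_l => x x0a; apply: phi_ub => //.
  by apply: relax_mono x0a; case/andP: ad => /ltW.
have [Q /definable_locally_constant[P P0 Pcst] QE] := definable_relaxed g f.
have Pphi a : 0 < a <= d0 -> P.[a%:P].[phi a] = 0.
  move=> ad; apply/eqP; apply: contraT => /Pcst /nbhs_ballP[e /= e0 eP].
  have e2 : 0 < e / 2 by rewrite divr_gt0.
  have e2e : e / 2 < e by rewrite ltr_pdivrMr // mulr_natr mulr2n ltrDl.
  have Qup : ~ Q [:: a; phi a + e / 2].
    move=> /QE[x /(phi_ub _ _ ad) /[swap] /le_trans /[apply]].
    by rewrite gerDl leNgt e2.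
  have Qdown : Q [:: a; phi a - e / 2].
    apply/QE; have [_ [x xa <-] fx] := sup_adherent e2 (img_sup _ ad).
    by exists x => //; exact: ltW.
  case: Qup; apply/eP.
    by rewrite /ball /= opprD addNKr normrN gtr0_norm.
  by apply/(eP (phi a - e / 2)) => //; rewrite /ball /= subKr gtr0_norm.
have [|q [C [d [C0 d_gt0 dP]]]] := algebraic_rate (l := l) P0 d0_gt0 Pphi.
  move=> e e0; have [d d_gt0 dP] := upper e e0.
  exists (Num.min d d0) => [|a /andP[a0]]; first by rewrite lt_min d_gt0.
  rewrite le_min => /andP[ad ad0]; have aP : 0 < a <= d0 by rewrite a0.
  rewrite ger0_norm ?subr_ge0 ?phi_ge // lerBlDl.
  apply: sup_le_ub; first by have [] := img_sup _ aP.
  by move=> _ [x xa <-]; apply/ltW/(dP a).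
exists q, C, (Num.min d d0); split=> //; first by rewrite lt_min d_gt0.
move=> a x /andP[a0]; rewrite le_min => /andP[ad ad0] xa lx.
have aP : 0 < a <= d0 by rewrite a0.
apply: le_trans (dP a _); last by rewrite a0.
rewrite ger0_norm ?subr_ge0 ?phi_ge // lerXn2r ?nnegrE ?subr_ge0 ?phi_ge //.
by rewrite lerD2r phi_ub.
Qed.

(** * Squares of the variables *)

Section SquareSubstitution.
Context (R : realType) (n : nat).
Implicit Types (p q : mpoly n R) (m : multinom n).

Definition squares : n.-tuple (mpoly n R) := [tuple mpolyX R (mnm1 i) ^+ 2 | i < n].

Definition half_mnm m : multinom n := Multinom [tuple (m i)./2 | i < n].

Lemma comp_squares_X m : comp_mpoly squares (mpolyX R m) = mpolyX R m ^+ 2.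
Proof.
rewrite comp_mpolyX [in RHS]mpolyXE_id -prodrXl; apply: eq_bigr => i _.
by rewrite tnth_mktuple exprAC.
Qed.

Lemma mcoeff_sign_flip p m i :
  mcoeff m (comp_mpoly (sign_flip R i) p) = (-1) ^+ m i * mcoeff m p.
Proof.
have XE a : comp_mpoly (sign_flip R i) (mpolyX R a) = (-1) ^+ a i *: mpolyX R a.
  rewrite comp_mpolyX [in RHS]mpolyXE_id.
  rewrite (bigD1 i) //= [in RHS](bigD1 i) //= tnth_mktuple eqxx [in LHS]exprNn scalerAl.
  congr (_ * _); last first.
    by apply: eq_bigr => j ji; rewrite tnth_mktuple (negPf ji).
  rewrite -signr_odd -(signr_odd R).
  by case: odd; rewrite ?expr1 ?expr0 ?scaleN1r ?mulN1r ?scale1r ?mul1r.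
rewrite comp_mpolyEX [in RHS](mpolyE p) !raddf_sum /= mulr_sumr; apply: eq_bigr => a _.
rewrite XE !mcoeffZ mcoeffX; case: eqP => [->|]; last by rewrite !mulr0.
by rewrite !mulr1 mulrC.
Qed.

Lemma even_mpoly_msupp p m i : even_mpoly p -> m \in msupp p -> ~~ odd (m i).
Proof.
move=> /(_ i) pE; rewrite mcoeff_msupp; apply: contra => odd_mi.
have := mcoeff_sign_flip p m i; rewrite pE -signr_odd odd_mi mulN1r => /eqP.
by rewrite -addr_eq0 -mulr2n mulrn_eq0.
Qed.

(** The bound on the size of q is what turns the half degree of f into the degree
    on the orthant. *)
Lemma even_mpoly_comp_squares p : even_mpoly p ->
  exists2 q, p = comp_mpoly squares q & (msize q <= (msize p).-1 %/ 2 + 1)%N.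
Proof.
move=> p_even.
exists (\sum_(m <- msupp p) mcoeff m p *: mpolyX R (half_mnm m)).
  rewrite raddf_sum /= {1}[p]mpolyE !big_seq; apply: eq_bigr => m mp.
  rewrite comp_mpolyZ comp_squares_X expr2 -mpolyXD; congr (_ *: mpolyX _ _).
  apply/mnmP => i; rewrite mnmDE mnmE addnn.
  by rewrite -[LHS]odd_double_half (negPf (even_mpoly_msupp i p_even mp)).
apply: (leq_trans (mmeasure_sum _ _ _ _)).
apply/bigmax_leqP_seq => m mp _; apply: (leq_trans (mmeasureZ_le _ _ _)).
rewrite mmeasureX addn1 ltnS leq_divRL //.
have /leq_trans : (mdeg (half_mnm m) * 2 <= mdeg m)%N.
  rewrite !mdegE big_distrl /= leq_sum // => i _; rewrite mnmE muln2.
  by rewrite -[X in (_ <= X)%N]odd_double_half leq_addl.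
by apply; rewrite -ltnS prednK ?msize_mdeg_lt // (leq_trans _ (msize_mdeg_lt mp)).
Qed.

Lemma meval_comp_squares p (x : 'I_n -> R) :
  meval x (comp_mpoly squares p) = meval (fun i => x i ^+ 2) p.
Proof.
rewrite comp_mpoly_meval; apply: meval_eq => i /=.
by rewrite tnth_mktuple rmorphXn /= mevalXU.
Qed.

Lemma msize_comp_squares p N :
  (msize p <= N.+1)%N -> (msize (comp_mpoly squares p) <= (2 * N).+1)%N.
Proof.
move=> pN; rewrite comp_mpolyEX; apply: (leq_trans (mmeasure_sum _ _ _ _)).
apply/bigmax_leqP_seq => m mp _; apply: (leq_trans (mmeasureZ_le _ _ _)).
rewrite comp_squares_X expr2 -mpolyXD msizeX mdegD addnn -mul2n ltnS leq_mul2l /=.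
by rewrite -ltnS (leq_trans (msize_mdeg_lt mp)).
Qed.

Lemma Sigma1_comp_squares p : (forall m, 0 <= mcoeff m p) ->
  Sigma 1 (comp_mpoly squares p).
Proof.
move=> p_ge0.
exists [seq (Num.sqrt (mcoeff m p) *: mpolyX R m) ^+ 2 | m <- msupp p].
  move=> q /mapP[m _ ->]; exists (fun=> Num.sqrt (mcoeff m p)), (fun=> m).
  by rewrite big_ord1.
rewrite comp_mpolyEX [in RHS]big_map; apply: eq_bigr => m _.
by rewrite comp_squares_X exprZn sqr_sqrtr.
Qed.

Lemma comp_squares_simplex_poly :
  comp_mpoly squares (simplex_poly R n) = 1 + sqnormX R n.
Proof.
rewrite rmorphD rmorph1 raddf_sum /=; congr (_ + _).
by apply: eq_bigr => i _; rewrite comp_squares_X.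
Qed.

End SquareSubstitution.

(** * The hierarchy for even polynomials *)

Section EvenOptimization.
Context (R : realType) (n m : nat) (g : 'I_m.+1 -> mpoly n R) (L : R) (f : mpoly n R).
Context (g_even : forall j, even_mpoly (g j)) (L_gt0 : 0 < L)
  (g_first : g ord0 = mpolyC n L - sqnormX R n) (g_last : g ord_max = 1)
  (f_even : even_mpoly f).

Let d := half_deg_succ f.

Lemma meval_sqnormX (x : 'I_n -> R) : meval x (sqnormX R n) = \sum_i x i ^+ 2.
Proof. by rewrite raddf_sum /=; apply: eq_bigr => i _; rewrite rmorphXn /= mevalXU. Qed.

(** The ball constraint is treated apart: its homogenization must have degree
    exactly 1, even when n = 0, for the penalty to be effective near slack = 0. *)
Lemma even_data : exists (G : 'I_m.+1 -> mpoly n R) (e : 'I_m.+1 -> nat) (F : mpoly n R),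
  [/\ forall j, g j = comp_mpoly (squares R n) (G j),
      forall j, (msize (G j) <= (e j).+1)%N,
      f = comp_mpoly (squares R n) F, (msize F <= d.+1)%N &
      e ord0 = 1%N /\ G ord0 = mpolyC n L - \sum_(i < n) mpolyX R (mnm1 i)].
Proof.
have half j : exists q, g j = comp_mpoly (squares R n) q.
  by have [q] := even_mpoly_comp_squares (g_even j); exists q.
have [H HE] := boolp.choice half.
have [F fE Fd] := even_mpoly_comp_squares f_even.
pose G j := if j == ord0 then mpolyC n L - \sum_(i < n) mpolyX R (mnm1 i) else H j.
exists G, (fun j => if j == ord0 then 1%N else msize (H j)), F; split.
- move=> j; rewrite /G; case: eqP => [->|_]; last exact: HE.
  rewrite g_first raddfB /= comp_mpolyC; congr (_ - _); rewrite [RHS]raddf_sum.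
  by apply: eq_bigr => i _; rewrite /= comp_squares_X.
- by move=> j; rewrite /G; case: eqP => // _; exact: msize_ball_poly.
- exact: fE.
- by rewrite (leq_trans Fd) // /d /half_deg_succ.
- by rewrite /G eqxx.
Qed.

(** The remainder r is added to the multiplier of the last constraint, which is
    1; this also works if the first constraint is the last one. *)
Lemma certified_bound_of_orthant (G : 'I_m.+1 -> mpoly n R) (F : mpoly n R) (k : nat)
    (lam : R) :
  (forall j, g j = comp_mpoly (squares R n) (G j)) ->
  f = comp_mpoly (squares R n) F ->
  orthant_certificate G F d k lam -> certified_bound g f k 1 lam.
Proof.
move=> gE fE [sigma [r [s0 r0 sd rd E]]].
pose sq := comp_mpoly (squares R n).
have sq_add : Sigma 1 (sq r) by exact: Sigma1_comp_squares.
have Sigma_sq j : Sigma 1 (sq (sigma j)) by apply: Sigma1_comp_squares => b; exact: s0.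
pose tau j := if j == ord_max then sq (sigma j) + sq r else sq (sigma j).
have tau_g j : tau j * g j = sq (sigma j * G j) + (if j == ord_max then sq r else 0).
  rewrite /tau /sq rmorphM /= -gE; case: eqP => [->|_]; last by rewrite addr0.
  by rewrite mulrDl g_last !mulr1.
exists tau; split.
- move=> j; rewrite /tau; case: eqP => // _.
  have [l lP ->] := Sigma_sq j; have [l' lP' ->] := sq_add.
  exists (l ++ l'); last by rewrite big_cat.
  by move=> q; rewrite mem_cat => /orP[/lP|/lP'].
- move=> j; rewrite /deg_le tau_g (leq_trans (msizeD_le _ _)) // geq_max.
  rewrite msize_comp_squares //=; case: eqP => _; last by rewrite msize0.
  exact: msize_comp_squares.
under eq_bigr do rewrite tau_g.
have := congr1 sq E; rewrite /sq rmorphM rmorphXn /= comp_squares_simplex_poly.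
rewrite raddfB /= comp_mpolyC -fE => ->.
by rewrite big_split /= -big_mkcond big_pred1_eq raddfD raddf_sum.
Qed.

(** The main estimate: a gap eta on the set relaxed by delta is certified as soon
    as k is of order 1 / (delta^2 eta).  Every y in the orthant is of the form
    x^2, so that gaps for the even problem are gaps on the orthant. *)
Lemma certified_bound_of_gap (Lam : R) : 0 <= Lam ->
  exists2 K : R, 0 < K & forall (lam delta eta : R) (k : nat),
    `|lam| <= Lam -> 0 < delta <= 1 -> 0 < eta <= 1 ->
    (forall x, relaxed_set g delta x -> meval x f <= lam - eta) ->
    K <= k%:R * (delta ^+ 2 * eta) -> certified_bound g f k 1 lam.
Proof.
move=> Lam0; have [G [e [F [gE Ge fE Fd [e0 G0]]]]] := even_data.
have [K K0 KP] := orthant_certificate_of_gap Ge Fd L_gt0 Lam0 e0 G0.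
exists K => // lam delta eta k lamL delta01 eta01 gap Kk.
apply: (certified_bound_of_orthant gE fE); apply: KP Kk => // y y0 Gy.
have sqE p : meval (fun i => Num.sqrt (y i)) (comp_mpoly (squares R n) p) = meval y p.
  by rewrite meval_comp_squares; apply: meval_eq => i; rewrite sqr_sqrtr.
by rewrite -sqE -fE; apply: gap => j; rewrite gE sqE.
Qed.

Lemma certified_bound_exists : exists lam, forall k, certified_bound g f k 1 lam.
Proof.
have [G [e [F [gE Ge fE Fd [e0 G0]]]]] := even_data.
have [lam cert0] := orthant_certificate0 Fd L_gt0 G0.
exists lam => k; apply: (certified_bound_of_orthant gE fE).
by elim: k => // k; exact: orthant_certificate_up.
Qed.

Lemma Sigma_mono s (p : mpoly n R) : (0 < s)%N -> Sigma 1 p -> Sigma s p.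
Proof.
case: s => // s _ [l lP ->]; exists l => // q /lP [a [alpha ->]].
exists (fun i => if i == ord0 then a ord0 else 0), (fun=> alpha ord0).
by rewrite big_ord1 big_ord_recl eqxx big1 ?addr0 // => i _; rewrite scale0r.
Qed.

Lemma certified_bound_mono k s lam : (0 < s)%N ->
  certified_bound g f k 1 lam -> certified_bound g f k s lam.
Proof.
by move=> s0 [sigma [sS sd sE]]; exists sigma; split=> // j; exact: Sigma_mono.
Qed.

Lemma Sigma_ge0 s (p : mpoly n R) (x : 'I_n -> R) : Sigma s p -> 0 <= meval x p.
Proof.
move=> [l lP ->]; rewrite raddf_sum big_seq sumr_ge0 // => q /lP [a [alpha ->]].
by rewrite /= rmorphXn sqr_ge0.
Qed.

Lemma certified_bound_sound k s lam (x : 'I_n -> R) :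
  certified_bound g f k s lam -> (forall j, 0 <= meval x (g j)) -> meval x f <= lam.
Proof.
move=> [sigma [sS _ E]] xg; have := congr1 (meval x) E.
rewrite rmorphM rmorphXn rmorphD rmorph1 /= meval_sqnormX raddfB /= mevalC [RHS]raddf_sum /= => Ex.
have w_gt0 : 0 < (1 + \sum_i x i ^+ 2) ^+ k.
  by rewrite exprn_gt0 // ltr_pwDl // sumr_ge0 // => i _; rewrite sqr_ge0.
rewrite -subr_ge0 -(pmulr_rge0 _ w_gt0) Ex sumr_ge0 // => j _.
by rewrite mevalM mulr_ge0 // (Sigma_ge0 _ (sS j)).
Qed.

Lemma feasible_rowE (x : 'I_n -> R) :
  feasible_set g (\row_i x i) <-> forall j, 0 <= meval x (g j).
Proof.
have E p : meval ((\row_i x i) ord0) p = meval x p.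
  by apply: meval_eq => i; rewrite mxE.
by split=> xg j; have := xg j; rewrite E.
Qed.

Lemma relaxed_set0E (x : 'I_n -> R) :
  relaxed_set g 0 x <-> forall j, 0 <= meval x (g j).
Proof. by split=> xg j; have := xg j; rewrite oppr0. Qed.

Lemma relaxed_set_bounded x : relaxed_set g 1 x -> forall i, `|x i| <= L + 2.
Proof.
move=> /(_ ord0); rewrite g_first raddfB /= mevalC meval_sqnormX => xL i.
have : x i ^+ 2 <= L + 1.
  have : x i ^+ 2 <= \sum_i x i ^+ 2.
    by rewrite (bigD1 i) //= lerDl sumr_ge0 // => j _; rewrite sqr_ge0.
  lra.
move=> xi2; have L0 := L_gt0; have L2 : 0 <= L + 2 by lra.
rewrite -(ler_pXn2r (n := 2)) ?nnegrE // real_normK ?num_real // (le_trans xi2) //.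
nra.
Qed.

Lemma le_fstar (x : 'I_n -> R) : relaxed_set g 0 x -> ((meval x f)%:E <= fstar g f)%E.
Proof.
move=> /relaxed_set0E /feasible_rowE xg; apply: ereal_sup_ubound => /=.
by exists (\row_i x i) => //; congr EFin; apply: meval_eq => i; rewrite mxE.
Qed.

Lemma fstar_le (u : \bar R) :
  (forall x, relaxed_set g 0 x -> ((meval x f)%:E <= u)%E) -> (fstar g f <= u)%E.
Proof.
move=> uP; apply: ge_ereal_sup => _ [x xg <-]; apply: uP.
by apply/relaxed_set0E => j; exact: xg.
Qed.

Lemma fstar_le_rho k s : (fstar g f <= rho g f k s)%E.
Proof.
apply: le_ereal_inf_tmp => _ [lam cert <-]; apply: fstar_le => x /relaxed_set0E xg.
by rewrite lee_fin; exact: certified_bound_sound cert xg.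
Qed.

Lemma rho_le k s lam : (0 < s)%N -> certified_bound g f k 1 lam ->
  (rho g f k s <= lam%:E)%E.
Proof.
by move=> s0 cert; apply: ereal_inf_lbound; exists lam => //; exact: certified_bound_mono.
Qed.

Lemma rho_le_rho1 k s : (0 < s)%N -> (rho g f k s <= rho g f k 1)%E.
Proof. by move=> s0; apply: le_ereal_inf_tmp => _ [lam cert <-]; exact: rho_le. Qed.

(** If lam exceeds the maximum, so does some smaller mu; by compactness mu is still
    a bound on a relaxed feasible set, which leaves a gap of lam - mu. *)
Lemma rho_eventually_le lam : (fstar g f < lam%:E)%E ->
  exists k0 : nat, forall k s, (k0 <= k)%N -> (0 < s)%N -> (rho g f k s <= lam%:E)%E.
Proof.
move=> f_lam.
have [mu f_mu mu_lam] : exists2 mu : R, (fstar g f < mu%:E)%E & mu < lam.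
  case: (fstar g f) f_lam => [l| |] //.
    by rewrite lte_fin => llam; exists ((l + lam) / 2); rewrite ?lte_fin; lra.
  by exists (lam - 1); rewrite ?ltNyr //; lra.
have [|delta [delta0 delta1 gap]] :=
    relaxed_upper_bound (f := f) (lam := mu) relaxed_set_bounded.
  by move=> x /le_fstar /le_lt_trans /(_ f_mu); rewrite lte_fin.
have [K K0 KP] := certified_bound_of_gap (normr_ge0 lam).
pose eta := Num.min 1 (lam - mu).
have eta0 : 0 < eta by rewrite lt_min ltr01 subr_gt0.
have w0 : 0 < delta ^+ 2 * eta by rewrite mulr_gt0 ?exprn_gt0.
exists (Num.truncn (K / (delta ^+ 2 * eta))).+1 => k s k0 s0; apply: rho_le => //.
apply: (KP lam delta eta) => //.
- by rewrite delta0.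
- by rewrite eta0 ge_min lexx.
- by move=> x /gap /ltW /le_trans; apply; rewrite lerBrDl -lerBrDr ge_min lexx orbT.
rewrite -ler_pdivrMr //; apply/ltW/(lt_le_trans (truncnS_gt _)).
by rewrite ler_nat.
Qed.

Lemma rho_cvg s : (0 < s)%N -> rho g f k s @[k --> \oo] --> fstar g f.
Proof.
move=> s0; have [lam0 cert0] := certified_bound_exists.
have f_lam0 : (fstar g f <= lam0%:E)%E.
  by apply: (le_trans (fstar_le_rho 0 1)); apply: rho_le.
have near_le lam : (fstar g f < lam%:E)%E -> \forall k \near \oo, (rho g f k s <= lam%:E)%E.
  by move=> /rho_eventually_le[k0 kP]; exists k0 => // k /= k0k; exact: kP.
case E : (fstar g f) f_lam0 near_le => [l| |] // _ near_le.
  move=> A Anbhs; have /nbhs_ballP[e /= e0 eA] : nbhs l (fun r => A r%:E) := Anbhs.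
  have [k0 _ kP] := near_le (l + e / 2) (ltac:(by rewrite lte_fin ltrDl divr_gt0)).
  exists k0 => // k /kP rho_up; have := fstar_le_rho k s; rewrite E => rho_low.
  have := rho_up; have := rho_low; case Er : (rho g f k s) => [r| |] //.
  rewrite !lee_fin => lr rl; rewrite /= Er; apply: eA.
  rewrite /ball /= distrC ger0_norm ?subr_ge0 //.
  lra.
move=> A [M [_ MA]]; have [k0 _ kP] := near_le (M - 1) (ltNyr _).
exists k0 => // k /kP /le_lt_trans; move=> /(_ M%:E) h; apply/MA/h.
by rewrite lte_fin; lra.
Qed.

Lemma fstar_fin : (exists x, relaxed_set g 0 x) -> exists l : R, fstar g f = l%:E.
Proof.
move=> [x0 x0g]; have [lam0 cert0] := certified_bound_exists.
have f_lam0 : (fstar g f <= lam0%:E)%E.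
  by apply: (le_trans (fstar_le_rho 0 1)); apply: rho_le.
by have := le_fstar x0g; case: (fstar g f) f_lam0 => // l; exists l.
Qed.

Lemma powR_rate (z : R) (c : nat) : 0 < z -> (0 < c)%N ->
  powR (z ^- c) (- (1 / c%:R)) = z.
Proof.
move=> z0 c0; have c_neq0 : c%:R != 0 :> R by rewrite pnatr_eq0 -lt0n.
rewrite -powR_mulrn ?ltW // -powRN -powRrM.
by rewrite mulrNN mul1r divff // powRr1 // ltW.
Qed.

(** By [relaxed_rate], f <= l + e on the set relaxed by w e^(q+1), so
    [certified_bound_of_gap] certifies l + 2 e once k e^(2q+3) is of order 1.  For
    the finitely many k for which this would need e > 1, the uniform bound lam0 is
    used instead, and it determines the constant cbar. *)
Lemma rho_rate : (exists x, relaxed_set g 0 x) ->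
  exists cbar c : R, [/\ 0 < cbar, 0 < c & forall s k : nat, (0 < s)%N ->
    (0 <= rho g f k s - fstar g f)%E /\ (rho g f k s - fstar g f <= rate cbar c k)%E].
Proof.
move=> S_neq0; have [l lE] := fstar_fin S_neq0.
have [lam0 cert0] := certified_bound_exists.
have [q [C [d0 [C0 d0_gt0 growth]]]] : exists (q : nat) (C d : R), [/\ 0 < C, 0 < d &
    forall (a : R) x, 0 < a <= d -> relaxed_set g a x -> l <= meval x f ->
      (meval x f - l) ^+ q.+1 <= C * a].
  apply: relaxed_rate S_neq0 _ _; first exact: relaxed_set_bounded.
    by move=> x /le_fstar; rewrite lE lee_fin.
  by move=> u uP; rewrite -lee_fin -lE; apply: fstar_le => x /uP; rewrite lee_fin.
have [K K0 KP] := certified_bound_of_gap (Lam := `|l| + 2) (ltac:(by rewrite addr_ge0)).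
pose w : R := Num.min (Num.min 1 d0) C^-1.
have w0 : 0 < w by rewrite !lt_min ltr01 d0_gt0 invr_gt0.
have w1 : w <= 1 by rewrite !ge_min lexx.
have wd : w <= d0 by rewrite !ge_min lexx orbT.
have wC : C * w <= 1 by rewrite mulrC -ler_pdivlMr // div1r ge_min lexx orbT.
have cert (e : R) k : 0 < e <= 1 -> K <= k%:R * (w ^+ 2 * e ^+ (2 * q.+1 + 1)) ->
    certified_bound g f k 1 (l + 2 * e).
  move=> /andP[e0 e1] Kk.
  have eq0 : 0 < e ^+ q.+1 by rewrite exprn_gt0.
  have eq1 : e ^+ q.+1 <= 1 by rewrite exprn_ile1 // ltW.
  have we0 : 0 < w * e ^+ q.+1 by rewrite mulr_gt0.
  have wew : w * e ^+ q.+1 <= w by rewrite ler_piMr // ltW.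
  apply: (KP _ (w * e ^+ q.+1) e) => //.
  - by rewrite (le_trans (ler_normD _ _)) // lerD2l gtr0_norm ?mulr_gt0 //; lra.
  - by rewrite we0 (le_trans wew).
  - by rewrite e0.
  - move=> x xd; have -> : l + 2 * e - e = l + e by ring.
    have [lx|/ltW xl] := leP l (meval x f); last by apply: (le_trans xl); rewrite lerDl ltW.
    rewrite -lerBlDl -(ler_pXn2r (n := q.+1)) ?nnegrE ?subr_ge0 ?(ltW e0) //.
    apply: (le_trans (growth _ _ _ xd lx)); first by rewrite we0 (le_trans wew).
    by rewrite mulrA ler_piMl // ltW.
  have -> : (w * e ^+ q.+1) ^+ 2 * e = w ^+ 2 * e ^+ (2 * q.+1 + 1).
    by rewrite exprMn -exprM mulnC -mulrA addn1 [e ^+ _.+1]exprSr.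
  by [].
pose c := (2 * q.+1 + 1)%N.
pose A := K / w ^+ 2.
have A0 : 0 < A by rewrite divr_gt0 ?exprn_gt0.
have l_lam0 : l <= lam0.
  by rewrite -lee_fin -lE (le_trans (fstar_le_rho 0 1)) // rho_le.
(* M is at least 2, for the bound l + 2 * e, and at least lam0 - l, for small k. *)
pose M := 2 + (lam0 - l).
have M0 : 0 < M by rewrite /M; lra.
exists (M ^+ c * A), c%:R; split.
- by rewrite mulr_gt0 ?exprn_gt0.
- by rewrite ltr0n /c addn1.
move=> s k s0; rewrite lE; split.
  by rewrite sube_ge0 // -lE; exact: fstar_le_rho.
rewrite /rate; case: eqP => [_|/eqP]; first exact: leey.
rewrite -lt0n => k0; have kR : 0 < k%:R :> R by rewrite ltr0n.
rewrite leeBlDr //.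
have t0 : 0 < A / k%:R by rewrite divr_gt0.
pose e := powR (A / k%:R) (c%:R^-1).
have e0 : 0 < e by exact: powR_gt0.
have ec : e ^+ c = A / k%:R.
  rewrite -powR_mulrn ?ltW // -powRrM mulVf ?powRr1 ?ltW //.
  by rewrite pnatr_eq0 /c addn1.
have -> : k%:R / (M ^+ c * A) = (M * e) ^- c.
  by rewrite exprMn ec [in RHS]mulrA [RHS]invf_div.
rewrite powR_rate ?mulr_gt0 ?/c ?addn1 //.
rewrite -EFinD.
have [e1|/ltW e1] := leP e 1.
  apply: (@le_trans _ _ (l + 2 * e)%:E).
    apply: rho_le => //; apply: cert; first by rewrite e0.
    have -> : k%:R * (w ^+ 2 * e ^+ c) = K.
      by rewrite ec /A; field; rewrite !gt_eqF.
    by [].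
  by rewrite lee_fin addrC lerD2r ler_wpM2r ?(ltW e0) // /M; lra.
apply: (@le_trans _ _ lam0%:E); first exact: rho_le.
rewrite lee_fin -lerBlDr; apply: (@le_trans _ _ M); first by rewrite /M; lra.
by rewrite ler_peMr // ltW.
Qed.

End EvenOptimization.

Theorem corollary2 (R : realType) (n m : nat) (g : 'I_m.+1 -> mpoly n R)
    (L : R) (f : mpoly n R)
    (g_even : forall j, even_mpoly (g j))
    (L_gt0 : 0 < L)
    (g_first : g ord0 = mpolyC n L - sqnormX R n)
    (g_last : g ord_max = 1)
    (f_even : even_mpoly f)
    (f_ge0 : forall x, feasible_set g x -> 0 <= meval (x ord0) f) :
  [/\ forall k s : nat, (0 < s)%N ->
        (rho g f k s <= rho g f k 1)%E /\ (fstar g f <= rho g f k s)%E,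
      forall s : nat, (0 < s)%N -> rho g f k s @[k --> \oo] --> fstar g f &
      interior (feasible_set g) !=set0 ->
        exists cbar c : R,
          [/\ 0 < cbar, 0 < c &
              forall s k : nat, (0 < s)%N ->
                (0 <= rho g f k s - fstar g f)%E /\
                (rho g f k s - fstar g f <= rate cbar c k)%E]].
Proof.
split.
- move=> k s s0; split; last exact: fstar_le_rho.
  exact: rho_le_rho1.
- by move=> s s0; apply: (rho_cvg g_even L_gt0 g_first g_last f_even).
move=> [x /interior_subset xg]; apply: (rho_rate g_even L_gt0 g_first g_last f_even).
by exists (x ord0) => j; rewrite oppr0; exact: xg.
Qed.
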